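(* Let $q,\rho_{12},\rho_{13},\rho_{23}\in(-1,1)$, $r=\rho_{12}\rho_{13}\rho_{23}$, and let $(X,Y,Z)$ have the joint density $f_{3D}(x,y,z|\rho_{12},\rho_{13},\rho_{23},q)$ defined in the context. Then the conditional distribution of $X$ given $Y=y,Z=z$ has density $$f_{X|Y=y,Z=z}(x|y,z,\rho_{12},\rho_{13},\rho_{23},q)=f_N(x|q)\frac{(\rho_{12}^2)_\infty(\rho_{13}^2)_\infty\prod_{i=0}^\infty\omega_q(y,z|\rho_{12}\rho_{13}q^i)}{(\rho_{12}^2\rho_{13}^2)_\infty\prod_{i=0}^\infty\left(\omega_q(x,y|\rho_{12}q^i)\,\omega_q(x,z|\rho_{13}q^i)\right)}$$ $$=\frac{f_{CN}(x|y,\rho_{12},q)f_{CN}(z|x,\rho_{13},q)}{f_{CN}(z|y,\rho_{12}\rho_{13},q)},$$ and the conditional distribution of $(Y,Z)$ given $X=x$ has density $$f_{Y,Z|X=x}(y,z|x,\rho_{12},\rho_{13},\rho_{23},q)=\frac{f_{CN}(x|y,\rho_{12},q)f_{CN}(y|z,\rho_{23},q)f_{CN}(z|x,\rho_{13},q)}{f_{CN}(x|x,r,q)}.$$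
   Context: For $|q|<1$ let $S(q)=[-2/\sqrt{1-q},2/\sqrt{1-q}]$ and $(a)_\infty=\prod_{k=0}^\infty(1-aq^k)$. Define $$l_q(x|a)=(1+a)^2-(1-q)ax^2,\qquad \omega_q(x,y|\rho)=(1-\rho^2)^2-(1-q)xy\rho(1+\rho^2)+(1-q)\rho^2(x^2+y^2),$$ $$f_N(x|q)=\frac{(q)_\infty\sqrt{1-q}\sqrt{4-(1-q)x^2}}{2\pi}\prod_{i=1}^\infty l_q(x|q^i),\qquad f_{CN}(x|y,\rho,q)=f_N(x|q)\frac{(\rho^2)_\infty}{\prod_{i=0}^\infty\omega_q(x,y|\rho q^i)}.$$ The three-dimensional density is, for $x,y,z\in S(q)$, $$f_{3D}(x,y,z|\rho_{12},\rho_{13},\rho_{23},q)=f_N(x|q)f_N(y|q)f_N(z|q)\frac{C_{3D}(\rho_{12}^2)_\infty(\rho_{13}^2)_\infty(\rho_{23}^2)_\infty}{\prod_{i=0}^\infty\left(\omega_q(x,y|\rho_{12}q^i)\,\omega_q(x,z|\rho_{13}q^i)\,\omega_q(y,z|\rho_{23}q^i)\right)},$$ with $C_{3D}$ the constant making it a probability density on $S(q)^3$. Conditional densities are understood in the usual sense (joint density divided by the marginal density of the conditioning variables, for almost every value of the latter). *)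

(* Defs.v *)
From HB Require Import structures.
From mathcomp Require Import all_boot all_order all_algebra.
From mathcomp Require Import all_classical all_reals all_analysis.
Import Order.TTheory GRing.Theory Num.Theory.
Import numFieldNormedType.Exports.

Set Implicit Arguments.
Unset Strict Implicit.
Unset Printing Implicit Defensive.

Local Open Scope classical_set_scope.
Local Open Scope ring_scope.

Section lebesgue2.
Variable R : realType.

Definition lebesgue2 : set (measurableTypeR R * measurableTypeR R) -> \bar R :=
  (@lebesgue_measure R \x @lebesgue_measure R)%E.

HB.instance Definition _ := Measure.on lebesgue2.

Let lebesgue2_sigma_finite : sigma_finite setT lebesgue2.
Proof.
have /sigma_finiteP[F [TF ndF Foo]] := sigma_finiteT (@lebesgue_measure R).
exists (fun n => F n `*` F n).
  rewrite -setXTT TF predeqE => -[x y]; split.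
    move=> [/= [n _ Fnx] [k _ Fky]]; exists (maxn n k) => //; split.
    - by move: x Fnx; exact/subsetPset/ndF/leq_maxl.
    - by move: y Fky; exact/subsetPset/ndF/leq_maxr.
  by move=> [n _ []/= ? ?]; split; exists n.
move=> k; have [? ?] := Foo k; split; first exact: measurableX.
by rewrite /lebesgue2 product_measure1E// lte_mul_pinfty// ge0_fin_numE.
Qed.

(* the product of two sigma-finite measures is sigma-finite, but the library
   instance of this fact is not found by inference *)
HB.instance Definition _ :=
  Measure_isSigmaFinite.Build _ _ _ lebesgue2 lebesgue2_sigma_finite.

End lebesgue2.

Section functions.
Variable R : realType.
Implicit Types (a q rho x y z : R).

(* limit of the partial products, \prod_(0 <= k < oo) u k *)
Definition infprod (u : nat -> R) : R :=
  limn (fun n => \prod_(0 <= k < n) u k).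

Definition qpoch a q : R := infprod (fun k => 1 - a * q ^+ k).

Definition Sq q : set R :=
  `[- (2 / Num.sqrt (1 - q)), 2 / Num.sqrt (1 - q)].

Definition lq x a q : R := (1 + a) ^+ 2 - (1 - q) * a * x ^+ 2.

Definition omega x y rho q : R :=
  (1 - rho ^+ 2) ^+ 2 - (1 - q) * x * y * rho * (1 + rho ^+ 2)
  + (1 - q) * rho ^+ 2 * (x ^+ 2 + y ^+ 2).

Definition omega_prod x y rho q : R :=
  infprod (fun i => omega x y (rho * q ^+ i) q).

Definition fN x q : R :=
  qpoch q q * Num.sqrt (1 - q) * Num.sqrt (4 - (1 - q) * x ^+ 2) / (2 * pi)
  * infprod (fun i => lq x (q ^+ i.+1) q).

(* f_CN(x | y, rho, q) *)
Definition fCN x y rho q : R :=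
  fN x q * (qpoch (rho ^+ 2) q / omega_prod x y rho q).

(* f_3D without the factor C_3D *)
Definition f3D_unnorm x y z rho12 rho13 rho23 q : R :=
  fN x q * fN y q * fN z q
  * (qpoch (rho12 ^+ 2) q * qpoch (rho13 ^+ 2) q * qpoch (rho23 ^+ 2) q
     / infprod (fun i => omega x y (rho12 * q ^+ i) q
                         * omega x z (rho13 * q ^+ i) q
                         * omega y z (rho23 * q ^+ i) q)).

Definition C3D rho12 rho13 rho23 q : R :=
  (\int[(@lebesgue_measure R \x @lebesgue2 R)%E]_(p in
      Sq q `*` (Sq q `*` Sq q))
    f3D_unnorm p.1 p.2.1 p.2.2 rho12 rho13 rho23 q)^-1.

Definition f3D x y z rho12 rho13 rho23 q : R :=
  C3D rho12 rho13 rho23 q * f3D_unnorm x y z rho12 rho13 rho23 q.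

End functions.

Section densities.
Context d (T : measurableType d) (R : realType) (P : probability T R).
Local Open Scope ereal_scope.

(* The law of X is carried by D and has density f on D with respect to mu;
   the values of f outside D are irrelevant. *)
Definition has_density {d1} {U : measurableType d1}
    (mu : {measure set U -> \bar R}) (X : T -> U) (D : set U) (f : U -> R) :=
  [/\ measurable_fun D f,
      (forall u, D u -> (0 <= f u)%R) &
      forall A, measurable A ->
        P (X @^-1` A) = \int[mu]_(u in A `&` D) (f u)%:E].

(* k u w, for u in D and almost every w in E, is the conditional density at u
   of X given W = w: the joint density h of (X, W) on D x E divided by the
   marginal density g of W on E (which is unique almost everywhere). *)
Definition is_cond_density {d1 d2} {U : measurableType d1} {V : measurableType d2}
    (mu : {sigma_finite_measure set U -> \bar R})
    (nu : {sigma_finite_measure set V -> \bar R})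
    (X : T -> U) (W : T -> V) (D : set U) (E : set V)
    (h : U * V -> R) (k : U -> V -> R) :=
  has_density (mu \x nu) (fun t => (X t, W t)) (D `*` E) h /\
  exists g : V -> R, has_density nu W E g /\
    {ae nu, forall w, E w ->
      (0 < g w)%R /\ forall u, D u -> (k u w = h (u, w) / g w)%R}.

End densities.

(* Main.v *)
Require Import Defs.
From HB Require Import structures.
From mathcomp Require Import all_boot all_order all_algebra.
From mathcomp Require Import all_classical all_reals all_analysis.
From mathcomp Require Import measurable_realfun.
From mathcomp Require Import ring lra.
Import Order.TTheory GRing.Theory Num.Theory.
Import numFieldNormedType.Exports.

(** Write k_a (x, y) = (a^2)_oo / prod_i omega_q (x, y | a q^i) for the ratio of
    fCN (x | y, a, q) and fN (x | q); it is symmetric in x and y. The joint density is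
    a constant times fN(x) fN(y) fN(z) k_rho12 (x, y) k_rho13 (x, z) k_rho23 (y, z), so
    both conditional densities follow from one identity, the Chapman-Kolmogorov
    equation for fCN (lemma [chapman_kolmogorov]):

      the integral over S(q) of fN(x) k_a (x, y) k_b (x, z) dx is k_(ab) (y, z).

    Used once it integrates x out of the joint density and leaves the marginal of
    (Y, Z); used for z and then for y it leaves the marginal of X. The normalizing
    constant cancels in the quotients. The marginals are positive except at the end
    points of S(q), where fN vanishes, and these form a null set.

    The Chapman-Kolmogorov equation comes from the continuous q-Hermite polynomials
    H_n, taken at sqrt (1 - q) x. They diagonalize all kernels k_a at once by the
    Poisson-Mehler formula ([poisson_mehler])

      k_a (x, y) = sum_n a^n H_n (x) H_n (y) / (q; q)_n,

    and they are orthogonal for fN, with squared norms (q; q)_n ([moment_qHM]).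
    Integrating a product of two such series therefore multiplies the parameters a
    and b; this is done on partial sums, which converge boundedly.

    The Poisson-Mehler formula holds because the sum M(a) of the series satisfies
    omega (a) M(a) = (1 - a^2) (1 - q a^2) M(q a), which is a consequence of the
    three-term recurrence of the H_n ([mehler_partial]), and M(0) = 1: iterating the
    equation produces the two infinite products.

    Orthogonality reduces, again by the three-term recurrence, to the fact that H_n has
    mean 0 for n > 0 and that fN has mass 1 ([moment_qH]). After the substitution
    sqrt (1 - q) x = 2 cos t the density is the infinite product over k of
    (1 - q^k e^(2it)) (1 - q^k e^(-2it)), up to a constant. For the product of its first
    N factors the mean of every H_n is known in closed form, by induction on N starting
    from the Fourier expansion of H_n ([trunc_momentP]); for n > 0 it tends to 0. *)

Set Implicit Arguments.
Unset Strict Implicit.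
Unset Printing Implicit Defensive.

Local Open Scope classical_set_scope.
Local Open Scope ring_scope.

(** * Continuous q-Hermite polynomials *)

Section qhermite.
Context {R : realType}.
Variable q : R.
Hypothesis hq : -1 < q < 1.

(** The finite q-Pochhammer symbol (q; q)_n. *)
Definition qpochn n : R := \prod_(0 <= k < n) (1 - q * q ^+ k).

Lemma normq1 : `|q| < 1. Proof. by rewrite ltr_norml. Qed.

Lemma oneBqX_gt0 n : 0 < 1 - q * q ^+ n.
Proof.
rewrite -exprS subr_gt0 (le_lt_trans (ler_norm _))// normrX.
by rewrite exprn_ilt1// normq1.
Qed.

Lemma onePqX_gt0 n : 0 < 1 + q ^+ n.
Proof.
case: n => [|n]; first by rewrite expr0.
rewrite -ltrBlDl sub0r; have : `|q ^+ n.+1| < 1 by rewrite normrX exprn_ilt1// normq1.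
by rewrite ltr_norml => /andP[].
Qed.

Lemma qpochn0 : qpochn 0 = 1.
Proof. by rewrite /qpochn big_geq. Qed.

Lemma qpochnS n : qpochn n.+1 = qpochn n * (1 - q * q ^+ n).
Proof. by rewrite /qpochn big_nat_recr. Qed.

Lemma qpochn_gt0 n : 0 < qpochn n.
Proof.
elim: n => [|n IH]; first by rewrite qpochn0.
by rewrite qpochnS mulr_gt0// oneBqX_gt0.
Qed.

Lemma qpochn_neq0 n : qpochn n != 0.
Proof. by rewrite gt_eqF// qpochn_gt0. Qed.

(** The Gaussian binomial coefficient. *)
Definition qbin n k : R :=
  if (k <= n)%N then qpochn n / (qpochn k * qpochn (n - k)) else 0.

Lemma qbin_small n k : (n < k)%N -> qbin n k = 0.
Proof. by rewrite /qbin ltnNge => /negbTE ->. Qed.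

Lemma qbin0 n : qbin n 0 = 1.
Proof. by rewrite /qbin leq0n subn0 qpochn0 mul1r divff// qpochn_neq0. Qed.

(** The coefficients of a given cosine on both sides of the three-term recurrence
    of the q-Hermite polynomials are related in this way; the identity combines
    Pascal's rule with the absorption rule. *)
Lemma qbinS n k : qbin n.+2 k.+1 =
  qbin n.+1 k.+1 + qbin n.+1 k - (1 - q * q ^+ n) * qbin n k.
Proof.
rewrite /qbin; case: (ltngtP k n.+1) => [kn|kn|->].
- have [j ->] : exists j, n = (k + j)%N by exists (n - k)%N; rewrite subnKC.
  rewrite !ltnS !leq_addr leqW ?leq_addr//.
  rewrite !subSS -!addnS !addKn !addnS !qpochnS !exprS !exprD.
  have A := qpochn_neq0 k; have B := qpochn_neq0 j; have C := qpochn_neq0 (k + j).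
  have D : 1 - q * q ^+ k != 0 by rewrite gt_eqF// oneBqX_gt0.
  have E : 1 - q * q ^+ j != 0 by rewrite gt_eqF// oneBqX_gt0.
  by field; rewrite ?A ?B ?D ?E.
- rewrite [(k < n.+2)%N]ltnNge kn /= leqNgt (ltnW kn)/=.
  by rewrite mulr0 addr0 subr0.
- rewrite leqnn ltnn !subnn qpochn0.
  have A := qpochn_neq0 n.+1; have B := qpochn_neq0 n.+2.
  by field; rewrite A B.
Qed.

(** The continuous q-Hermite polynomials, in the variable 2 cos t. The factor
    1 - q ^+ 0 kills the term of index -1, for which 0 stands. *)
Fixpoint qH n : {poly R} :=
  match n with
  | 0 => 1
  | n'.+1 => 'X * qH n' -
     (1 - q ^+ n') *: match n' with 0 => 0 | m.+1 => qH m end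
  end.

Lemma qH0 : qH 0 = 1. Proof. by []. Qed.

Lemma qH1 : qH 1 = 'X.
Proof. by rewrite /= expr0 subrr scale0r subr0 mulr1. Qed.

Lemma qHSS n : qH n.+2 = 'X * qH n.+1 - (1 - q * q ^+ n) *: qH n.
Proof. by rewrite -exprS. Qed.

Lemma qHE n (s : R) :
  (qH n.+2).[s] = s * (qH n.+1).[s] - (1 - q * q ^+ n) * (qH n).[s].
Proof. by rewrite qHSS !hornerE. Qed.

(** Rogers' Fourier expansion. It gives the integral of [qH n] over a half period,
    and a bound on [-2, 2] that grows only linearly in n. *)
Lemma qH_cos n (t : R) : (qH n).[2 * cos t] =
  \sum_(0 <= k < n.+1) qbin n k * cos ((n%:R - 2 * k%:R) * t).
Proof.
suff : (qH n).[2 * cos t] =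
  \sum_(0 <= k < n.+1) qbin n k * cos ((n%:R - 2 * k%:R) * t) /\
  (qH n.+1).[2 * cos t] =
  \sum_(0 <= k < n.+2) qbin n.+1 k * cos ((n.+1%:R - 2 * k%:R) * t) by case.
elim: n => [|n [IH0 IH1]].
  rewrite qH1 qH0 !hornerE !big_nat_recr//= !big_geq// !add0r.
  have -> : qbin 1 1 = 1.
    by rewrite /qbin leqnn subnn qpochn0 mulr1 divff ?qpochn_neq0.
  have -> : (1 - 2 * 1) * t = - t by ring.
  have -> : - (2 * 0%:R) * t = 0 by ring.
  have -> : (1 - 2 * 0%:R) * t = t by ring.
  by rewrite cosN cos0 !qbin0; split; ring.
split => //; rewrite qHE IH0 IH1.
pose c k := cos ((n.+2%:R - 2 * k%:R) * t).
have cE k : 2 * cos t * cos ((n.+1%:R - 2 * k%:R) * t) = c k + c k.+1.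
  have -> : c k = cos ((n.+1%:R - 2 * k%:R) * t + t).
    by rewrite /c; congr cos; rewrite -[n.+2%:R]natr1; ring.
  have -> : c k.+1 = cos ((n.+1%:R - 2 * k%:R) * t - t).
    by rewrite /c; congr cos; rewrite -[n.+2%:R]natr1 -[k.+1%:R]natr1; ring.
  rewrite cosD cosB; ring.
have c'E k : cos ((n%:R - 2 * k%:R) * t) = c k.+1.
  rewrite /c; congr cos.
  by rewrite -[n.+2%:R]natr1 -[n.+1%:R]natr1 -[k.+1%:R]natr1; ring.
rewrite big_distrr /=.
rewrite (eq_bigr (fun k => qbin n.+1 k * c k + qbin n.+1 k * c k.+1)); last first.
  by move=> k _; rewrite mulrCA cE mulrDr.
rewrite big_split/=.
(* the three sums are brought to the range k <= n.+2, where qbin is padded by 0 *)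
rewrite [X in X + _ - _](_ : _ = \sum_(0 <= k < n.+3) qbin n.+1 k * c k); last first.
  by rewrite [RHS]big_nat_recr//= qbin_small// mul0r addr0.
rewrite [X in _ - X](_ : _ = \sum_(0 <= k < n.+2)
    (1 - q * q ^+ n) * (qbin n k * c k.+1)); last first.
  rewrite [RHS]big_nat_recr//= qbin_small// mul0r mulr0 addr0 big_distrr/=.
  by apply: eq_bigr => k _; rewrite c'E.
rewrite [X in X + _ - _]big_nat_recl// [RHS]big_nat_recl// -addrA -addrA.
congr (_ + _).
  by rewrite !qbin0.
rewrite -sumrB -big_split/=; apply: eq_bigr => k _.
by rewrite qbinS /c; ring.
Qed.

(** A new factor of the truncated weight is a combination of 1 and 'X^2, so this
    rule turns the passage from one truncation to the next into a recursion on the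
    moments of the [qH n]. *)
Lemma qH_X2 n (b := fun k => 1 - q * q ^+ k) : 'X^2 * qH n.+2 =
  qH n.+4 + (b n.+1 + b n.+2) *: qH n.+2 + (b n * b n.+1) *: qH n.
Proof.
rewrite (qHSS n.+2) (qHSS n.+1) (qHSS n) {}/b.
move: (1 - q * q ^+ n) (1 - q * q ^+ n.+1) (1 - q * q ^+ n.+2) => x y z.
by rewrite -!mul_polyC polyCD polyCM; ring.
Qed.

(** * Moments of the truncated weights *)

(** At 2 cos t the k-th factor is (1 - q^k e^(2it)) (1 - q^k e^(-2it)); up to a
    constant, the infinite product is the density fN in the variable t. *)
Definition trunc_weight N : {poly R} :=
  \prod_(0 <= k < N) (((1 + q ^+ k) ^+ 2)%:P - q ^+ k *: 'X^2).

Section functional.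
Variable L : {poly R} -> R.
Hypothesis LD : forall p r, L (p + r) = L p + L r.
Hypothesis LZ : forall a p, L (a *: p) = a * L p.
Variable c : R.
Hypothesis L_even : forall m, L (qH m.*2) = c * qbin m.*2 m.
Hypothesis L_odd : forall m, L (qH m.*2.+1) = 0.

Lemma trunc_weightS N p : L (trunc_weight N.+1 * p) =
  (1 + q ^+ N) ^+ 2 * L (trunc_weight N * p)
  - q ^+ N * L (trunc_weight N * ('X^2 * p)).
Proof.
rewrite /trunc_weight big_nat_recr//= -[- (_ * L _)]mulNr -!LZ -LD; congr L.
by rewrite -!mul_polyC polyCN; ring.
Qed.

Let LWZ N a p : L (trunc_weight N * (a *: p)) = a * L (trunc_weight N * p).
Proof. by rewrite -scalerAr LZ. Qed.

Definition trunc_moment N m : R :=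
  2 * c / (1 + q ^+ N) * (qpochn N.*2 * qpochn m.*2 * q ^+ (N * m))
  / (qpochn N * qpochn m * qpochn (N + m)).

(** The closed form satisfies the recursion in N provided by [qH_X2], and at N = 0
    it is the hypothesis on L. Its factor q^(N m) makes the moments with m > 0
    vanish in the limit: this is where the orthogonality of the [qH n] under fN
    comes from. *)
Lemma trunc_momentP N m :
  L (trunc_weight N * qH m.*2) = trunc_moment N m /\
  L (trunc_weight N * qH m.*2.+1) = 0.
Proof.
elim: N m => [|N IH] m.
  rewrite /trunc_weight big_geq// !mul1r L_even L_odd /trunc_moment; split=> //.
  rewrite /qbin -addnn leq_addr addnK qpochn0 mul0n expr0 add0n.
  by field; rewrite ?qpochn_neq0.
split; rewrite trunc_weightS.
- case: m => [|m].
    have -> : 'X^2 * qH 0.*2 = qH 1.*2 + (1 - q) *: qH 0.*2.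
      by rewrite double0 -[qH 1.*2]/(qH 2) qHSS qH1 qH0 expr0 mulr1 -!mul_polyC; ring.
    rewrite mulrDr LD LWZ !(IH _).1 /trunc_moment.
    rewrite !doubleS double0 addn1 !addn0 muln1 !muln0 !qpochnS expr0 !qpochn0 mulr1.
    have A := qpochn_neq0 N.
    have B : 1 - q * q ^+ N != 0 by rewrite gt_eqF// oneBqX_gt0.
    have C : 1 + q ^+ N != 0 by rewrite gt_eqF// onePqX_gt0.
    have D : 1 + q * q ^+ N != 0 by rewrite -exprS gt_eqF// onePqX_gt0.
    have E : 1 - q != 0 by have := oneBqX_gt0 0; rewrite expr0 mulr1 => /gt_eqF ->.
    rewrite -addnn !exprS !exprD.
    by field; rewrite A B C D E.
  rewrite doubleS qH_X2; move: (IH m.+2).1 (IH m.+1).1 (IH m).1; rewrite !doubleS.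
  move: (qH m.*2.+4) (qH m.*2.+2) (qH m.*2) => h4 h2 h0 e4 e2 e0.
  rewrite !mulrDr !LD !LWZ e4 e2 e0 /trunc_moment.
  rewrite !(mulnS, mulSn, addnS, addSn, doubleS, qpochnS, expr2) !exprS !exprD.
  have A := qpochn_neq0 N.
  have B : 1 - q * q ^+ N != 0 by rewrite gt_eqF// oneBqX_gt0.
  have C : 1 + q ^+ N != 0 by rewrite gt_eqF// onePqX_gt0.
  have D : 1 + q * q ^+ N != 0 by rewrite -exprS gt_eqF// onePqX_gt0.
  have E : 1 - q * q ^+ m != 0 by rewrite gt_eqF// oneBqX_gt0.
  have F : 1 - q * (q * q ^+ m) != 0 by rewrite -exprS gt_eqF// oneBqX_gt0.
  have G := qpochn_neq0 m.
  have G' := qpochn_neq0 (N + m).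
  have H : 1 - q * (q ^+ N * q ^+ m) != 0 by rewrite -exprD gt_eqF// oneBqX_gt0.
  have H' : 1 - q * (q * (q ^+ N * q ^+ m)) != 0.
    by rewrite -exprD -exprS gt_eqF// oneBqX_gt0.
  rewrite -!addnn !exprD.
  by field; rewrite A B C D E F G G' H H'.
- case: m => [|m].
    have -> : 'X^2 * qH 0.*2.+1 =
        qH 1.*2.+1 + ((1 - q * q) + (1 - q)) *: qH 0.*2.+1.
      rewrite -[qH 1.*2.+1]/(qH 3) qHSS (qHSS 0) qH1 qH0 expr0 expr1.
      by rewrite -!mul_polyC polyCD; ring.
    move: (IH 1).2 (IH 0).2; move: (qH 1.*2.+1) (qH 0.*2.+1) => h2 h0 e2 e0.
    by rewrite mulrDr LD LWZ e2 e0 !mulr0 addr0 mulr0 subrr.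
  rewrite doubleS qH_X2; move: (IH m.+2).2 (IH m.+1).2 (IH m).2; rewrite !doubleS.
  move: (qH m.*2.+4.+1) (qH m.*2.+3) (qH m.*2.+1) => h4 h2 h0 e4 e2 e0.
  by rewrite !mulrDr !LD !LWZ e4 e2 e0 !(mulr0, addr0) subrr.
Qed.

End functional.
End qhermite.

#[global] Arguments qH {R} q n : simpl never.

(** * Orthogonality from the three-term recurrence *)

Section orthogonality.
Context {R : realType}.
Variable q : R.
Hypothesis hq : -1 < q < 1.
Local Notation qH := (qH q).
Local Notation qpochn := (qpochn q).

(** Multiplication by 'X is symmetric for the form (p, r) |-> E (p * r), so the
    three-term recurrence can be moved from one factor to the other; this reduces
    every pair of indices to one with m = 0. *)
Lemma qH_orthogonal (E : {poly R} -> R) :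
  (forall p r, E (p + r) = E p + E r) -> (forall a p, E (a *: p) = a * E p) ->
  (forall n, E (qH n) = (n == 0%N)%:R) ->
  forall m n, E (qH m * qH n) = (m == n)%:R * qpochn n.
Proof.
move=> ED EZ EH m n.
suff [] : (forall n, E (qH m * qH n) = (m == n)%:R * qpochn n) /\
  (forall n, E (qH m.+1 * qH n) = (m.+1 == n)%:R * qpochn n) by [].
have E0 : forall n, E (qH 0 * qH n) = (0%N == n)%:R * qpochn n.
  move=> {}n; rewrite mul1r EH eq_sym.
  by case: n => [|n]; rewrite ?qpochn0 ?mulr1// mul0r.
have EZl a p r : E ((a *: p) * r) = a * E (p * r) by rewrite -scalerAl EZ.
have EZr a p r : E (p * (a *: r)) = a * E (p * r) by rewrite -scalerAr EZ.
have XH k : 'X * qH k.+1 = qH k.+2 + (1 - q * q ^+ k) *: qH k.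
  by rewrite qHSS subrK.
elim: m {n} => [|m [IH0 IH1]].
  split=> // n; rewrite qH1; case: n => [|n].
    by rewrite qH0 mulr1 -(qH1 q) EH mul0r.
  rewrite XH ED EZ !EH/= add0r eqSS eq_sym.
  case: n => [|n]; last by rewrite mulr0 mul0r.
  by rewrite expr0 !mulr1 qpochnS qpochn0 expr0 !mulr1 !mul1r.
split=> // n; rewrite qHSS mulrDl ED -scaleNr EZl IH0 mulNr.
rewrite -mulrA mulrCA; case: n => [|n].
  rewrite qH0 mulr1 -(qH1 q) IH1 !mul0r; case: m {IH0 IH1} => [|m]; last first.
    by rewrite !mul0r mulr0 subrr.
  by rewrite qpochnS qpochn0; ring.
rewrite XH mulrDr ED EZr !IH1 !eqSS; have [->|mn] := eqVneq m n.+1.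
  have -> : (n.+2 == n) = false by rewrite gtn_eqF.
  by rewrite !qpochnS !mulrb; ring.
have [<-|mn2] := eqVneq m.+1 n; first by rewrite !qpochnS !mulrb; ring.
by rewrite !mulrb; ring.
Qed.

End orthogonality.

(** * The functional equation of the Poisson-Mehler series *)

Section mehler_algebra.
Context {R : realType}.
Variable q : R.
Hypothesis hq : -1 < q < 1.
Variables s t : R.
Let u n := (qH q n).[s].
Let v n := (qH q n).[t].

Definition mehler_coef n : R := (qH q n).[s] * (qH q n).[t] / qpochn q n.

(** The polynomial omega_q in the variables s = sqrt (1 - q) x and
    t = sqrt (1 - q) y. *)
Definition mehler_den (r : R) : R :=
  (1 - r ^+ 2) ^+ 2 - s * t * r * (1 + r ^+ 2) + r ^+ 2 * (s ^+ 2 + t ^+ 2).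

(** The power series M with coefficients [mehler_coef] satisfies
      [mehler_den r * M r = (1 - r ^+ 2) * (1 - q * r ^+ 2) * M (q * r)].
    For its partial sums the defect is a bilinear form in the last two values of the
    q-Hermite polynomials at s and at t, because the three-term recurrence expresses
    all earlier values through these; once the form is known, induction applies. *)
Lemma mehler_partial r n :
  mehler_den r * \sum_(0 <= k < n.+1) mehler_coef k * r ^+ k
  - (1 - r ^+ 2) * (1 - q * r ^+ 2) *
    \sum_(0 <= k < n.+1) mehler_coef k * (q * r) ^+ k =
  r ^+ n.+1 / qpochn q n *
  ((r ^+ 2 - 1) * (u n.+1 * v n.+1) + (s * r - t * r ^+ 2) * (u n.+1 * v n)
   + (t * r - s * r ^+ 2) * (u n * v n.+1)
   + r * (1 - q * q ^+ n) * (r ^+ 2 - 1) * (u n * v n)).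
Proof.
elim: n => [|n IH].
  rewrite !big_nat_recr//= !big_geq// /mehler_coef /mehler_den /u /v qH1 qH0.
  rewrite -polyC1 !hornerX !hornerC.
  by rewrite qpochn0 !expr0 !expr1 invr1; ring.
rewrite !(@big_nat_recr _ _ _ n.+1)//=.
rewrite [LHS](_ : _ = mehler_den r * \sum_(0 <= k < n.+1) mehler_coef k * r ^+ k
  - (1 - r ^+ 2) * (1 - q * r ^+ 2) *
    \sum_(0 <= k < n.+1) mehler_coef k * (q * r) ^+ k +
  mehler_coef n.+1 * (mehler_den r * r ^+ n.+1 -
    (1 - r ^+ 2) * (1 - q * r ^+ 2) * (q * r) ^+ n.+1)); last first.
  ring.
rewrite IH /mehler_coef /mehler_den /u /v !qHE !qpochnS.
move: (qH q n.+1).[s] (qH q n).[s] (qH q n.+1).[t] (qH q n).[t] => a b c d.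
have A := qpochn_neq0 hq n.
have B : 1 - q * q ^+ n != 0 by rewrite gt_eqF// oneBqX_gt0.
rewrite !exprS !exprMn.
by field; rewrite A B.
Qed.

End mehler_algebra.

(** * Infinite products *)

Section infinite_products.
Context {R : realType}.
Implicit Types (u v : nat -> R) (C c e : R).

(** 1 + x <= exp x turns the product into a geometric series. *)
Lemma prod_bounded u C c : 0 <= c < 1 -> (forall k, `|u k - 1| <= C * c ^+ k) ->
  exists2 B, 0 < B & forall n, `|\prod_(0 <= k < n) u k| <= B.
Proof.
move=> /andP[c0 c1] uC.
have C0 : 0 <= C by have := le_trans (normr_ge0 _) (uC 0); rewrite expr0 mulr1.
exists (expR (C / (1 - c))); first exact: expR_gt0.
move=> n; apply: (@le_trans _ _ (expR (C * \sum_(0 <= k < n) c ^+ k))).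
  rewrite normr_prod big_distrr/= expR_sum; apply: ler_prod => k _.
  rewrite normr_ge0/=; apply: le_trans (expR_ge1Dx _).
  by rewrite -[u k](subrK 1) addrC (le_trans (ler_normD _ _))// normr1 lerD2l.
rewrite ler_expR; apply: ler_wpM2l => //.
have -> : \sum_(0 <= k < n) c ^+ k = (1 - c ^+ n) / (1 - c).
  have := geometric_seriesE 1 (negbT (lt_eqF c1)) => /(congr1 (fun f => f n))/=.
  by rewrite /series/= mul1r => <-; apply: eq_bigr => k _; rewrite mul1r.
rewrite -[leRHS]mul1r; apply: ler_wpM2r; first by rewrite invr_ge0 subr_ge0 ltW.
by rewrite gerBl exprn_ge0.
Qed.

(** As the partial products are bounded, their increments are dominated by the
    same geometric series as the u k - 1. *)
Lemma prod_cvg u C c : 0 <= c < 1 -> (forall k, `|u k - 1| <= C * c ^+ k) ->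
  cvgn (fun n => \prod_(0 <= k < n) u k).
Proof.
move=> c01 uC; have [B B0 uB] := prod_bounded c01 uC.
have /andP[c0 c1] := c01.
have C0 : 0 <= C by have := le_trans (normr_ge0 _) (uC 0); rewrite expr0 mulr1.
set p := (X in cvgn X).
have : cvgn (series (telescope p)).
  apply: normed_cvg.
  apply: (@series_le_cvg _ _ (geometric (B * C) c)) => [n|n|n|] /=.
  - exact: normr_ge0.
  - by rewrite mulr_ge0 ?exprn_ge0// mulr_ge0// ltW.
  - rewrite /telescope/= /p big_nat_recr//= -[X in _ - X]mulr1 -mulrBr normrM -mulrA.
    by rewrite ler_pM.
  - by apply: is_cvg_geometric_series; rewrite ger0_norm.
rewrite telescopeK => cp.
have -> : p = (fun n => (p n - p 0%N) + p 0%N) by apply/funext => n; rewrite subrK.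
by apply: is_cvgD => //; exact: is_cvg_cst.
Qed.

(** The inverses 1 / u k satisfy an estimate of the same kind, so their product
    converges as well, and its limit is an inverse of [infprod u]. *)
Lemma infprod_gt0 u C c e : 0 <= c < 1 -> (forall k, `|u k - 1| <= C * c ^+ k) ->
  0 < e -> (forall k, e <= u k) -> 0 < infprod u.
Proof.
move=> c01 uC e0 eu.
have u0 k : 0 < u k by exact: lt_le_trans (eu k).
have vC k : `|(u k)^-1 - 1| <= (C / e) * c ^+ k.
  have -> : (u k)^-1 - 1 = - ((u k - 1) / u k).
    by rewrite mulrBl divff ?gt_eqF// mul1r opprB.
  rewrite normrN normrM mulrAC ler_pM// normfV gtr0_norm//.
  by rewrite lef_pV2// posrE.
have cu := prod_cvg c01 uC; have cv := prod_cvg c01 vC.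
have uv : infprod u * limn (fun n => \prod_(0 <= k < n) (u k)^-1) = 1.
  rewrite /infprod -limM//; apply: cvg_lim => //.
  rewrite (_ : _ \* _ = cst 1); first exact: cvg_cst.
  apply/funext => n/=; rewrite -big_split/= big1// => k _.
  by rewrite divff// gt_eqF.
rewrite lt_neqAle; apply/andP; split.
  by apply/eqP => u00; move: uv; rewrite -u00 mul0r => /eqP; rewrite eq_sym oner_eq0.
apply: limr_ge => //; apply: nearW => n; apply: prodr_ge0 => k _; exact: ltW.
Qed.

Lemma infprodM u v : cvgn (fun n => \prod_(0 <= k < n) u k) ->
  cvgn (fun n => \prod_(0 <= k < n) v k) ->
  infprod (fun k => u k * v k) = infprod u * infprod v.
Proof.
move=> cu cv; rewrite /infprod -limM//; congr (limn _).
by apply/funext => n; rewrite big_split.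
Qed.

End infinite_products.

(** * Estimates for the factors of the densities *)

Section products.
Context {R : realType}.
Variable q : R.
Hypothesis hq : -1 < q < 1.
Implicit Types (a x y s t r : R).

(** The normalization that maps S(q) onto [-2, 2]. *)
Definition scale x := Num.sqrt (1 - q) * x.

Lemma scale_sqr x : scale x ^+ 2 = (1 - q) * x ^+ 2.
Proof. by rewrite exprMn sqr_sqrtr// subr_ge0; move: hq => /andP[_ /ltW]. Qed.

Lemma sqrt_gt0 : 0 < Num.sqrt (1 - q).
Proof. by rewrite sqrtr_gt0 subr_gt0; move: hq => /andP[]. Qed.

Lemma scale_Sq x : Sq q x -> `|scale x| <= 2.
Proof.
rewrite /Sq/= in_itv/= -ler_norml => xq.
rewrite normrM gtr0_norm ?sqrt_gt0// mulrC -ler_pdivlMr// sqrt_gt0//.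
Qed.

Lemma omegaE x y r : omega x y r q = mehler_den (scale x) (scale y) r.
Proof.
rewrite /omega /mehler_den !scale_sqr.
have -> : scale x * scale y = (1 - q) * x * y.
  rewrite mulrACA -expr2 sqr_sqrtr ?mulrA//.
  by rewrite subr_ge0; move: hq => /andP[_ /ltW].
by ring.
Qed.

Lemma lqE x a : lq x a q = (1 + a) ^+ 2 - a * scale x ^+ 2.
Proof. by rewrite /lq scale_sqr; ring. Qed.

(** For s = 2 cos u and t = 2 cos v the polynomial is
    (1 - 2 r cos (u + v) + r^2) (1 - 2 r cos (u - v) + r^2), and each factor is at
    least (1 - |r|)^2. In the proof A and B are 2 sin u and 2 sin v. *)
Lemma mehler_den_ge s t r : `|s| <= 2 -> `|t| <= 2 -> `|r| < 1 ->
  (1 - `|r|) ^+ 4 <= mehler_den s t r.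
Proof.
move=> s2 t2 r1.
have sq4 (z : R) : `|z| <= 2 -> 0 <= 4 - z ^+ 2.
  by rewrite ler_norml => /andP[? ?]; nra.
pose A := Num.sqrt (4 - s ^+ 2); pose B := Num.sqrt (4 - t ^+ 2).
have A2 : A ^+ 2 = 4 - s ^+ 2 by rewrite sqr_sqrtr ?sq4.
have B2 : B ^+ 2 = 4 - t ^+ 2 by rewrite sqr_sqrtr ?sq4.
have -> : mehler_den s t r =
   (1 + r ^+ 2 - r * (s * t + A * B) / 2) * (1 + r ^+ 2 - r * (s * t + (- A) * B) / 2).
  have -> : (1 + r ^+ 2 - r * (s * t + A * B) / 2) *
            (1 + r ^+ 2 - r * (s * t + (- A) * B) / 2)
    = (1 + r ^+ 2 - r * (s * t) / 2) ^+ 2 - r ^+ 2 * (A ^+ 2 * B ^+ 2) / 4 by field.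
  by rewrite /mehler_den A2 B2; field.
(* Cauchy-Schwarz for the vectors (s, A) and (t, B), both of norm 2 *)
have cs A' : A' ^+ 2 = A ^+ 2 -> `|s * t + A' * B| <= 4.
  move=> A'2; rewrite ler_norml; apply/andP; split.
    have := sqr_ge0 (s + t); have := sqr_ge0 (A' + B).
    by rewrite !sqrrD A'2 A2 B2 !mulr2n; lra.
  have := sqr_ge0 (s - t); have := sqr_ge0 (A' - B).
  by rewrite !sqrrB A'2 A2 B2 !mulr2n; lra.
have fac (w : R) : `|w| <= 4 -> (1 - `|r|) ^+ 2 <= 1 + r ^+ 2 - r * w / 2.
  move=> w4; have : r * w <= `|r| * 4.
    by rewrite (le_trans (ler_norm _))// normrM ler_wpM2l.
  by rewrite sqrrB expr1n mul1r real_normK ?num_real// mulr2n; lra.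
rewrite (_ : 4 = 2 + 2)%N// exprD ler_pM ?sqr_ge0//; apply: fac; apply: cs => //.
by rewrite sqrrN.
Qed.

Lemma mehler_den_sub1 s t r : `|s| <= 2 -> `|t| <= 2 -> `|r| <= 1 ->
  `|mehler_den s t r - 1| <= 19 * `|r|.
Proof.
move=> s2 t2 r1.
have -> : mehler_den s t r - 1 =
   r * (- (r * 2) + r * (r * r) - (s * t + (s * t) * (r * r)) + r * (s * s + t * t)).
  by rewrite /mehler_den; ring.
rewrite normrM mulrC; apply: ler_wpM2r => //.
have bM (z z' b b' : R) : `|z| <= b -> `|z'| <= b' -> `|z * z'| <= b * b'.
  by move=> ? ?; rewrite normrM ler_pM.
have bD (z z' b b' : R) : `|z| <= b -> `|z'| <= b' -> `|z + z'| <= b + b'.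
  by move=> ? ?; rewrite (le_trans (ler_normD _ _))// lerD.
have bN (z b : R) : `|z| <= b -> `|- z| <= b by rewrite normrN.
(* term by term in the formula above, with |r| <= 1 and |s|, |t| <= 2 *)
apply: (@le_trans _ _
  (1 * 2 + 1 * (1 * 1) + (2 * 2 + 2 * 2 * (1 * 1)) + 1 * (2 * 2 + 2 * 2))); last lra.
have n2 : `|2 : R| <= 2 by rewrite ger0_norm.
have rr := bM _ _ _ _ r1 r1; have st := bM _ _ _ _ s2 t2.
apply: (bD _ _ _ _); last first.
  by apply: (bM _ _ _ _ r1); apply: (bD _ _ _ _); exact: (bM _ _ _ _).
apply: (bD _ _ _ _); last first.
  by apply: (bN _ _); apply: (bD _ _ _ _) => //; exact: (bM _ _ _ _).
by apply: (bD _ _ _ _); [apply: (bN _ _)|]; exact: (bM _ _ _ _).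
Qed.

(** As (1 - q) x^2 ranges over [0, 4], the value lies between (1 - a)^2 and
    (1 + a)^2. *)
Lemma lq_bounds x a : Sq q x -> `|a| < 1 ->
  [/\ (1 - `|a|) ^+ 2 <= lq x a q, lq x a q <= (1 + `|a|) ^+ 2 &
      `|lq x a q - 1| <= 7 * `|a|].
Proof.
move=> /scale_Sq; rewrite lqE; move: (scale x) => s s2 a1.
have s4 : 0 <= s ^+ 2 <= 4.
  by rewrite sqr_ge0/=; move: s2; rewrite ler_norml => /andP[? ?]; nra.
move: s4 a1; move: (s ^+ 2) => z /andP[z0 z4].
rewrite ltr_norml => /andP[a1 a2].
have [a0|a0] := ger0P a.
  have h1 : 0 <= a * (1 - a) by rewrite mulr_ge0// subr_ge0 ltW.
  have h2 : 0 <= a * z by rewrite mulr_ge0.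
  have h3 : 0 <= a * (4 - z) by rewrite mulr_ge0// subr_ge0.
  by rewrite ler_norml !expr2; split; [nra|nra|apply/andP; split; nra].
have h1 : 0 <= (- a) * (1 + a) by rewrite mulr_ge0// ?oppr_ge0 ?ltW// -ltrBlDl sub0r.
have h2 : 0 <= (- a) * z by rewrite mulr_ge0// oppr_ge0 ltW.
have h3 : 0 <= (- a) * (4 - z) by rewrite mulr_ge0 ?subr_ge0// oppr_ge0 ltW.
by rewrite ler_norml !expr2; split; [nra|nra|apply/andP; split; nra].
Qed.

End products.

Section bounds.
Context {R : realType}.
Variable q : R.
Hypothesis hq : -1 < q < 1.
Implicit Types (a x y s t r : R).

Lemma normq01 : 0 <= `|q| < 1.
Proof. by rewrite normr_ge0 normq1. Qed.

Lemma normrqX a k : `|a * q ^+ k| = `|a| * `|q| ^+ k.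
Proof. by rewrite normrM normrX. Qed.

Lemma normrqX_le a k : `|a * q ^+ k| <= `|a|.
Proof.
rewrite normrqX -[leRHS]mulr1 ler_wpM2l// exprn_ile1//.
by have /andP[_ /ltW] := normq01.
Qed.

Lemma qpoch_cvg a : cvgn (fun n => \prod_(0 <= k < n) (1 - a * q ^+ k)).
Proof.
apply: (@prod_cvg _ _ `|a| _ normq01) => k.
by rewrite addrAC subrr add0r normrN normrqX.
Qed.

Lemma qpoch_gt0 a : `|a| < 1 -> 0 < qpoch a q.
Proof.
move=> a1; apply: (@infprod_gt0 _ _ `|a| _ (1 - `|a|) normq01) => [k||k].
- by rewrite addrAC subrr add0r normrN normrqX.
- by rewrite subr_gt0.
- by rewrite lerD2l lerN2 (le_trans (ler_norm _))// normrqX_le.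
Qed.

Lemma mehler_den_dist s t r k : `|s| <= 2 -> `|t| <= 2 -> `|r| < 1 ->
  `|mehler_den s t (r * q ^+ k) - 1| <= (19 * `|r|) * `|q| ^+ k.
Proof.
move=> s2 t2 r1; rewrite -mulrA -normrqX mehler_den_sub1//.
by rewrite (le_trans (normrqX_le _ _))// ltW.
Qed.

Lemma mehler_prod_cvg s t r : `|s| <= 2 -> `|t| <= 2 -> `|r| < 1 ->
  cvgn (fun n => \prod_(0 <= k < n) mehler_den s t (r * q ^+ k)).
Proof. by move=> s2 t2 r1; apply: (prod_cvg normq01) => k; exact: mehler_den_dist. Qed.

Lemma mehler_prod_gt0 s t r : `|s| <= 2 -> `|t| <= 2 -> `|r| < 1 ->
  0 < infprod (fun k => mehler_den s t (r * q ^+ k)).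
Proof.
move=> s2 t2 r1; apply: (@infprod_gt0 _ _ _ _ ((1 - `|r|) ^+ 4) normq01) => [k||k].
- exact: mehler_den_dist.
- by rewrite exprn_gt0// subr_gt0.
- have rk : `|r * q ^+ k| <= `|r| by exact: normrqX_le.
  apply: le_trans (mehler_den_ge s2 t2 (le_lt_trans rk r1)).
  apply: lerXn2r; rewrite ?nnegrE ?subr_ge0 ?lerD2l ?lerN2//; first exact: ltW.
  exact: le_trans rk (ltW r1).
Qed.

Lemma normr_qXS_lt1 k : `|q ^+ k.+1| < 1.
Proof. by rewrite normrX exprn_ilt1// normq1. Qed.

Lemma lq_dist x k : Sq q x ->
  `|lq x (q ^+ k.+1) q - 1| <= (7 * `|q|) * `|q| ^+ k.
Proof.
move=> xq; have [_ _] := lq_bounds hq xq (normr_qXS_lt1 k).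
by rewrite -mulrA -exprS -normrX.
Qed.

Lemma lq_prod_cvg x : Sq q x ->
  cvgn (fun n => \prod_(0 <= k < n) lq x (q ^+ k.+1) q).
Proof. by move=> xq; apply: (prod_cvg normq01) => k; exact: lq_dist. Qed.

Lemma lq_prod_gt0 x : Sq q x -> 0 < infprod (fun k => lq x (q ^+ k.+1) q).
Proof.
move=> xq; apply: (@infprod_gt0 _ _ _ _ ((1 - `|q|) ^+ 2) normq01) => [k||k].
- exact: lq_dist.
- by rewrite exprn_gt0// subr_gt0 normq1.
- have [+ _ _] := lq_bounds hq xq (normr_qXS_lt1 k); apply: le_trans.
  have /andP[q0 q1] := normq01.
  have qk : `|q ^+ k.+1| <= `|q| by rewrite normrX exprS ler_piMr// exprn_ile1// ltW.
  apply: lerXn2r; rewrite ?nnegrE ?subr_ge0 ?lerD2l ?lerN2//; first exact: ltW.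
  exact: le_trans qk (ltW q1).
Qed.

(** The bound does not depend on x, so the truncations of fN can be integrated and
    passed to the limit over the support. *)
Lemma lq_prod_bounded : exists2 B, 0 < B &
  forall x n, Sq q x -> `|\prod_(0 <= k < n) lq x (q ^+ k.+1) q| <= B.
Proof.
have [k|B B0 hB] := @prod_bounded _ (fun k => (1 + `|q ^+ k.+1|) ^+ 2) 3 _ normq01.
  have /andP[q0 q1] := normq01.
  have a0 : 0 <= `|q| ^+ k by exact: exprn_ge0.
  have a1 : `|q| ^+ k <= 1 by rewrite exprn_ile1// ltW.
  have b0 : 0 <= `|q| ^+ k.+1 by exact: exprn_ge0.
  have ba : `|q| ^+ k.+1 <= `|q| ^+ k by rewrite exprS ler_piMl// ltW.
  rewrite normrX; move: a0 a1 b0 ba.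
  move: (`|q| ^+ k) (`|q| ^+ k.+1) => a b a0 a1 b0 ba.
  rewrite sqrrD expr1n mul1r addrAC (addrC 1) addrK ger0_norm; first nra.
  by rewrite addr_ge0 ?mulrn_wge0 ?sqr_ge0.
exists B => // x n xq; apply: le_trans (hB n).
rewrite !normr_prod; apply: ler_prod => k _; rewrite normr_ge0/=.
have [l1 l2 _] := lq_bounds hq xq (normr_qXS_lt1 k).
have l0 := le_trans (sqr_ge0 _) l1.
by rewrite (ger0_norm l0) ger0_norm ?sqr_ge0.
Qed.

Lemma qpochn_bounded : exists2 B, 0 < B &
  forall n, qpochn q n <= B /\ (qpochn q n)^-1 <= B.
Proof.
have d k : `|1 - q * q ^+ k - 1| <= 1 * `|q| ^+ k.
  rewrite addrAC subrr add0r normrN normrqX ler_wpM2r ?exprn_ge0// ltW//.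
  exact: normq1.
have [B B0 hB] := prod_bounded normq01 d.
have := @qpoch_cvg q; rewrite -/(qpochn q) => qc.
have l0 : 0 < limn (qpochn q) by apply: qpoch_gt0; exact: normq1.
have : cvgn (fun n => (qpochn q n)^-1).
  by apply: is_cvgV => //; rewrite gt_eqF.
move=> /cvg_seq_bounded[M [_ /(_ (M + 1))]].
rewrite ltrDl ltr01 => /(_ isT) hM.
exists (Num.max B (M + 1)); first by rewrite lt_max B0.
move=> n; rewrite !le_max; split.
  by rewrite (le_trans (ler_norm _) (hB n)).
by rewrite (le_trans (ler_norm _) (hM n I)) orbT.
Qed.

(** In [qH_cos] there are n + 1 terms, and the Gaussian binomials are bounded
    because (q; q)_n stays away from 0. *)
Lemma qH_bounded : exists2 C, 0 < C &
  forall n s, `|s| <= 2 -> `|(qH q n).[s]| <= C * n.+1%:R.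
Proof.
have [B B0 hB] := qpochn_bounded.
exists (B * (B * B)); first by rewrite !mulr_gt0.
move=> n s s2.
have s21 : s / 2 \in `[(-1), 1].
  rewrite in_itv/= -ler_norml normrM normfV (ger0_norm (ler0n _ 2)).
  by rewrite ler_pdivrMr ?ltr0n// mul1r.
have [t ->] : exists t, s = 2 * cos t.
  by exists (acos (s / 2)); rewrite (acosK s21) mulrC divfK// pnatr_eq0.
rewrite qH_cos// (le_trans (ler_norm_sum _ _ _))//.
apply: (@le_trans _ _ (\sum_(0 <= k < n.+1) (B * (B * B)))); last first.
  by rewrite sumr_const_nat subn0 mulr_natr.
apply: ler_sum => k _; rewrite normrM.
have Q k' : 0 <= qpochn q k' by exact/ltW/qpochn_gt0.
rewrite -[leRHS]mulr1 ler_pM//; last first.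
  by rewrite ler_norml cos_geN1 cos_le1.
rewrite /qbin; case: ifP => _; last by rewrite normr0 !mulr_ge0// ltW.
rewrite normrM normfV normrM !ger0_norm// invfM.
by rewrite ler_pM ?mulr_ge0 ?invr_ge0// ?(hB _).1// ler_pM ?invr_ge0// (hB _).2.
Qed.

End bounds.

(** * The Poisson-Mehler formula *)

Section mehler.
Context {R : realType}.
Variable q : R.
Hypothesis hq : -1 < q < 1.
Implicit Types (a x y s t r c : R).

(** Each of the n + 1 terms c ^+ k, k <= n, of the geometric series is at least
    c ^+ n. *)
Lemma linear_geometric_le c n : 0 <= c < 1 -> n.+1%:R * c ^+ n <= (1 - c)^-1.
Proof.
move=> /andP[c0 c1].
apply: (@le_trans _ _ (\sum_(0 <= k < n.+1) c ^+ k)).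
  rewrite mulr_natl -[X in _ *+ X](subn0 n.+1) -sumr_const_nat.
  apply: ler_sum_nat => k /andP[_ kn].
  by rewrite ler_wiXn2l// ltW.
have := geometric_seriesE 1 (negbT (lt_eqF c1)) => /(congr1 (fun f => f n.+1))/=.
rewrite /series/= mul1r; under eq_bigr do rewrite mul1r; move=> ->.
by rewrite ler_piMl ?invr_ge0 ?subr_ge0 ?gerBl ?exprn_ge0// ltW.
Qed.

(** With c the fourth root of |r|, two of the four factors c ^+ n of |r| ^+ n absorb
    n.+1 ^+ 2 by the previous bound, and two remain. *)
Lemma quadratic_geometric_le r : `|r| < 1 -> exists B c,
  [/\ 0 < B, 0 <= c < 1 & forall n, n.+1%:R ^+ 2 * `|r| ^+ n <= B * c ^+ n].
Proof.
move=> r1; pose c := Num.sqrt (Num.sqrt `|r|).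
have c01 : 0 <= c < 1 by rewrite sqrtr_ge0/= -sqrtr1 ltr_sqrt// -sqrtr1 ltr_sqrt.
have /andP[c0 c1] := c01.
exists ((1 - c)^-1 ^+ 2), (c ^+ 2); split.
- by rewrite exprn_gt0// invr_gt0 subr_gt0.
- by rewrite sqr_ge0 expr_lt1.
- move=> n; have -> : `|r| ^+ n = (c ^+ n) ^+ 2 * (c ^+ 2) ^+ n.
    rewrite -(exprM c n 2) mulnC exprM -exprMn -expr2.
    by rewrite /c !sqr_sqrtr ?sqrtr_ge0.
  rewrite mulrA -exprMn ler_wpM2r ?exprn_ge0//.
  have h := linear_geometric_le n c01.
  by rewrite lerXn2r ?nnegrE// ?mulr_ge0 ?exprn_ge0// invr_ge0 subr_ge0 ltW.
Qed.

Local Notation m s t := (mehler_coef q s t).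

(** The bound is uniform in s and t, so it dominates the partial sums of the
    series when these are integrated. *)
Lemma mehler_coef_bound r : `|r| < 1 -> exists B c,
  [/\ 0 < B, 0 <= c < 1 & forall s t n, `|s| <= 2 -> `|t| <= 2 ->
    `|m s t n * r ^+ n| <= B * c ^+ n].
Proof.
move=> /quadratic_geometric_le[B [c [B0 c01 hB]]].
have [C C0 hC] := qH_bounded hq; have [D D0 hD] := qpochn_bounded hq.
exists (C * C * D * B), c; split=> //; first by rewrite !mulr_gt0.
move=> s t n s2 t2; rewrite -mulrA; apply: le_trans (ler_wpM2l _ (hB n)); last first.
  by rewrite !mulr_ge0// ltW.
rewrite normrM normrX mulrA ler_wpM2r ?exprn_ge0//.
rewrite /mehler_coef !normrM normfV (gtr0_norm (qpochn_gt0 hq n)).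
have -> : C * C * D * n.+1%:R ^+ 2 = (C * n.+1%:R) * (C * n.+1%:R) * D by ring.
by rewrite ler_pM ?mulr_ge0 ?invr_ge0 ?(hD n).2 ?ler_pM ?hC// ltW// qpochn_gt0.
Qed.

Section fixed.
Variables s t : R.
Hypotheses (s2 : `|s| <= 2) (t2 : `|t| <= 2).

Definition mehler_sum r := limn (series (fun n => m s t n * r ^+ n)).

Lemma mehler_sum_cvg r : `|r| < 1 ->
  cvgn (series (fun n => m s t n * r ^+ n)).
Proof.
move=> /mehler_coef_bound[B [c [B0 c01 hB]]].
apply: normed_cvg; apply: (@series_le_cvg _ _ (geometric B c)) => [n|n|n|] /=.
- exact: normr_ge0.
- by case/andP: c01 => c0 _; rewrite mulr_ge0 ?exprn_ge0// ltW.
- exact: hB.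
- by apply: is_cvg_geometric_series; case/andP: c01 => ? ?; rewrite ger0_norm.
Qed.

(** The defect in [mehler_partial] vanishes in the limit: the q-Hermite values grow
    linearly and r ^+ n.+1 decays geometrically. *)
Lemma mehler_boundary_cvg0 r : `|r| < 1 ->
  (fun n => r ^+ n.+1 / qpochn q n *
  ((r ^+ 2 - 1) * ((qH q n.+1).[s] * (qH q n.+1).[t])
   + (s * r - t * r ^+ 2) * ((qH q n.+1).[s] * (qH q n).[t])
   + (t * r - s * r ^+ 2) * ((qH q n).[s] * (qH q n.+1).[t])
   + r * (1 - q * q ^+ n) * (r ^+ 2 - 1) * ((qH q n).[s] * (qH q n).[t]))) @ \oo --> 0.
Proof.
move=> r1; have [B [c [B0 c01 hB]]] := quadratic_geometric_le r1.
have [C C0 hC] := qH_bounded hq; have [D D0 hD] := qpochn_bounded hq.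
have /andP[c0 c1] := c01.
(* 20 = 2 + 4 + 4 + 10 bounds the sum of the coefficients of the bilinear form *)
pose K := D * (20 * (C * C)) * B * c.
apply/norm_cvg0P.
apply: (@squeeze_cvgr _ _ _ _ (cst 0) (geometric K c)); last 2 first.
- exact: cvg_cst.
- by apply: cvg_geometric; rewrite ger0_norm.
apply: nearW => n; rewrite normr_ge0/=.
have -> : K * c ^+ n = D * (20 * (C * C)) * (B * c ^+ n.+1) by rewrite /K exprS; ring.
apply: le_trans (ler_wpM2l _ (hB n.+1)); last by rewrite !mulr_ge0// ltW.
have -> : D * (20 * (C * C)) * (n.+2%:R ^+ 2 * `|r| ^+ n.+1) =
   `|r| ^+ n.+1 * D * (20 * ((C * n.+2%:R) * (C * n.+2%:R))) by ring.
rewrite normrM ler_pM//.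
  rewrite normrM normrX ler_wpM2l ?exprn_ge0// normfV gtr0_norm ?qpochn_gt0//.
  exact: (hD n).2.
have uv k l x y : `|x| <= 2 -> `|y| <= 2 -> (k <= n.+1)%N -> (l <= n.+1)%N ->
   `|(qH q k).[x] * (qH q l).[y]| <= (C * n.+2%:R) * (C * n.+2%:R).
  move=> x2 y2 kn ln; rewrite normrM ler_pM//.
    by rewrite (le_trans (hC _ _ x2))// ler_wpM2l ?ler_nat// ltW.
  by rewrite (le_trans (hC _ _ y2))// ler_wpM2l ?ler_nat// ltW.
have r2 : `|r ^+ 2| <= 1 by rewrite normrX exprn_ile1// ltW.
have b1 : `|r ^+ 2 - 1| <= 2 by rewrite (le_trans (ler_normB _ _))// normr1; lra.
have bst x y : `|x| <= 2 -> `|y| <= 2 -> `|x * r - y * r ^+ 2| <= 4.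
  move=> x2 y2; rewrite (le_trans (ler_normB _ _))//.
  have -> : 4 = 2 * 1 + 2 * 1 :> R by ring.
  by rewrite (normrM x) (normrM y) lerD// ler_pM// ltW.
have b4 : `|r * (1 - q * q ^+ n) * (r ^+ 2 - 1)| <= 4.
  have -> : 4 = 1 * 2 * 2 :> R by ring.
  have b3 : `|1 - q * q ^+ n| <= 2.
    by rewrite (le_trans (ler_normB _ _))// normr1 -exprS lerD2l ltW// normr_qXS_lt1.
  by rewrite (normrM (_ * _)) (normrM r) ler_pM// ler_pM// ltW.
set E := C * n.+2%:R * (C * n.+2%:R).
have -> : 20 * E = 2 * E + 4 * E + 4 * E + 10 * E by ring.
rewrite (le_trans (ler_normD _ _))// lerD//.
  rewrite (le_trans (ler_normD _ _))// lerD//.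
    rewrite (le_trans (ler_normD _ _))// lerD//.
      by rewrite normrM; apply: ler_pM => //; exact: uv.
    by rewrite normrM; apply: ler_pM => //; [exact: bst|exact: uv].
  by rewrite normrM; apply: ler_pM => //; [exact: bst|exact: uv].
rewrite normrM; apply: ler_pM => //; last exact: uv.
by rewrite (le_trans b4)//; lra.
Qed.

Lemma mehler_sum_functional r : `|r| < 1 ->
  mehler_den s t r * mehler_sum r =
  (1 - r ^+ 2) * (1 - q * r ^+ 2) * mehler_sum (q * r).
Proof.
move=> r1; apply/eqP; rewrite -subr_eq0; apply/eqP.
have qr1 : `|q * r| < 1.
  by rewrite normrM mulr_ilt1//; exact: normq1.
apply: (@cvg_unique _ _ _ _ _ _ _ (mehler_boundary_cvg0 r1)) => //.
apply: (@cvg_trans _ ((fun n =>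
  mehler_den s t r * series (fun n => m s t n * r ^+ n) n.+1 -
  (1 - r ^+ 2) * (1 - q * r ^+ 2) *
    series (fun n => m s t n * (q * r) ^+ n) n.+1) @ \oo)).
  apply: near_eq_cvg; apply: nearW => n; rewrite /series/=; exact: mehler_partial.
by apply: cvgB; apply: cvgMr; rewrite cvg_shiftS; exact: mehler_sum_cvg.
Qed.

Lemma normr_mulqX_lt1 r N : `|r| < 1 -> `|r * q ^+ N| < 1.
Proof. exact: le_lt_trans (normrqX_le _ _ _). Qed.

(** The factors (1 - r^2) (1 - q r^2) of the successive steps line up to the first
    2 N factors of (r^2)_oo. *)
Lemma mehler_sum_iter r N : `|r| < 1 ->
  (\prod_(0 <= k < N) mehler_den s t (r * q ^+ k)) * mehler_sum r =
  (\prod_(0 <= k < N.*2) (1 - r ^+ 2 * q ^+ k)) * mehler_sum (r * q ^+ N).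
Proof.
move=> r1; elim: N => [|N IH]; first by rewrite !big_geq// expr0 mulr1.
rewrite big_nat_recr//= -mulrA (mulrC (mehler_den _ _ _)) mulrA IH.
rewrite doubleS !big_nat_recr//= -!mulrA; congr (_ * _).
rewrite mulrC mehler_sum_functional ?normr_mulqX_lt1//.
have -> : q * (r * q ^+ N) = r * q ^+ N.+1 by rewrite exprS; ring.
by rewrite -addnn [q ^+ (N + N).+1]exprS exprD; ring.
Qed.

(** Each term of positive index is at most |q|^N times the same term at r. *)
Lemma mehler_sum_near1 r : `|r| < 1 -> mehler_sum (r * q ^+ N) @[N --> \oo] --> (1 : R).
Proof.
move=> r1; have [B [c [B0 c01 hB]]] := mehler_coef_bound r1.
have /andP[c0 c1] := c01.
have main N : `|mehler_sum (r * q ^+ N) - 1| <= B / (1 - c) * `|q| ^+ N.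
  have cv := mehler_sum_cvg (normr_mulqX_lt1 N r1).
  set f := series _ in cv.
  have cvn : `|f n - 1| @[n --> \oo] --> `|mehler_sum (r * q ^+ N) - 1|.
    by apply: cvg_norm; apply: cvgB => //; exact: cvg_cst.
  apply: (cvgr_to_le cvn).
  exists 1%N => // -[//|n] _ /=; rewrite /f /series/= big_nat_recl//.
  rewrite /mehler_coef !qH0 qpochn0 expr0 -polyC1 !hornerC invr1 !mulr1.
  rewrite addrAC subrr add0r.
  rewrite (le_trans (ler_norm_sum _ _ _))//.
  apply: (@le_trans _ _ (\sum_(0 <= k < n) B * c ^+ k.+1 * `|q| ^+ N)).
    apply: ler_sum => k _; rewrite exprMn mulrA normrM -exprM ler_pM ?hB//.
    rewrite normrX mulnS exprD ler_piMr ?exprn_ge0// exprn_ile1//.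
    by have /andP[_ /ltW] := normq01 hq.
  rewrite -mulr_suml ler_wpM2r ?exprn_ge0//.
  have := geometric_seriesE B (negbT (lt_eqF c1)) => /(congr1 (fun f => f n.+1))/=.
  rewrite /series/= big_nat_recl//= expr0 mulr1 => e.
  apply: (@le_trans _ _ (B + \sum_(0 <= k < n) B * c ^+ k.+1)).
    by rewrite lerDr ltW.
  rewrite e ler_wpM2r ?invr_ge0 ?subr_ge0 ?(ltW c1)//.
  by rewrite ler_piMr ?(ltW B0)// gerBl exprn_ge0.
apply/subr_cvg0/norm_cvg0P.
apply: (@squeeze_cvgr _ _ _ _ (cst 0) (geometric (B / (1 - c)) `|q|)); last 2 first.
- exact: cvg_cst.
- by apply: cvg_geometric; rewrite normr_id; exact: normq1.
by apply: nearW => N; rewrite normr_ge0/=; exact: main.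
Qed.

(** Iterating the functional equation moves the argument to r q^N, where the series
    tends to its constant term 1, and leaves the two infinite products. *)
Lemma poisson_mehler r : `|r| < 1 ->
  mehler_sum r = qpoch (r ^+ 2) q / infprod (fun k => mehler_den s t (r * q ^+ k)).
Proof.
move=> r1; apply: (canRL (mulfK _)).
  by rewrite gt_eqF// mehler_prod_gt0.
have cd : (\prod_(0 <= k < N) mehler_den s t (r * q ^+ k)) * mehler_sum r
      @[N --> \oo] -->
    infprod (fun k => mehler_den s t (r * q ^+ k)) * mehler_sum r.
  by apply: cvgMl; exact: mehler_prod_cvg.
rewrite mulrC; apply: (cvg_unique _ cd) => //.
rewrite (_ : (fun N => _ * _) = (fun N =>
    (\prod_(0 <= k < N.*2) (1 - r ^+ 2 * q ^+ k)) * mehler_sum (r * q ^+ N)));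
  last first.
  by apply/funext => N; exact: mehler_sum_iter.
rewrite -[qpoch _ _]mulr1; apply: cvgM; last exact: mehler_sum_near1.
apply: (@cvg_comp _ _ _ (fun n => n.*2)
  (fun n => \prod_(0 <= k < n) (1 - r ^+ 2 * q ^+ k)) _ \oo); last exact: qpoch_cvg.
apply/cvgnyPge => A; exists A => // n /= An.
by rewrite -addnn (leq_trans An)// leq_addr.
Qed.

End fixed.
End mehler.

(** * Integrals of polynomials of a cosine *)

Section circle.
Context {R : realType}.
Local Notation mu := (@lebesgue_measure R).
Implicit Types (f g : R -> R) (p : {poly R}) (a b : R).

Lemma continuous_integrable f a b : continuous f ->
  mu.-integrable `[a, b] (EFin \o f).
Proof.
move=> cf; apply: continuous_compact_integrable; first exact: segment_compact.
exact: continuous_subspaceT.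
Qed.

Lemma sin_natmul_pi n : sin (n%:R * pi) = 0 :> R.
Proof.
elim: n => [|n IH]; first by rewrite mul0r sin0.
by rewrite -natr1 mulrDl mul1r sinDpi IH oppr0.
Qed.

Lemma continuous_cosM a : continuous (fun t : R => cos (a * t)).
Proof.
move=> t; apply: continuous_comp; last exact: continuous_cos.
by apply: cvgMr; exact: cvg_id.
Qed.

Lemma integral_cos_natmul n :
  (\int[mu]_(t in `[0%R, pi]) cos (n%:R * t))%R = if n == 0%N then pi else 0 :> R.
Proof.
case: n => [|n] /=.
  under eq_Rintegral do rewrite mul0r cos0.
  rewrite Rintegral_cst//= lebesgue_measure_itv/= lte_fin pi_gt0.
  by rewrite /= oppr0 addr0 mul1r.
pose F (t : R) := n.+1%:R^-1 * sin (n.+1%:R * t).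
have dF (t : R) : is_derive t (1 : R) F (cos (n.+1%:R * t)).
  have dm : is_derive t (1 : R) (n.+1%:R *: (id : R -> R)) (n.+1%:R : R).
    by apply: is_derive_eq; rewrite /GRing.scale/= mulr1.
  have ds : is_derive t (1 : R) (sin \o (n.+1%:R *: (id : R -> R)))
      (cos (n.+1%:R * t) * n.+1%:R).
    by apply: is_derive_eq.
  have : is_derive t (1 : R) (n.+1%:R^-1 *: (sin \o (n.+1%:R *: (id : R -> R))))
      (cos (n.+1%:R * t)).
    apply: is_derive_eq; rewrite /GRing.scale/= mulrCA mulVf ?mulr1// pnatr_eq0.
  by [].
have cF : continuous F.
  by move=> t; apply/differentiable_continuous/derivable1_diffP; case: (dF t).
rewrite /Rintegral (@continuous_FTC2 _ _ F) ?pi_gt0//.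
- by rewrite /F mulr0 sin0 sin_natmul_pi mulr0 subee.
- by apply: continuous_subspaceT; exact: continuous_cosM.
- split; first by move=> t _; case: (dF t).
  + exact/cvg_at_right_filter/cF.
  + exact/cvg_at_left_filter/cF.
- by move=> t _; rewrite derive1E; apply: derive_val.
Qed.

(** The integral of p against the Chebyshev weight, on [-2, 2]. *)
Definition circle p : R := (\int[mu]_(t in `[0%R, pi]) p.[2 * cos t])%R.

Lemma continuous_horner_cos p : continuous (fun t : R => p.[2 * cos t]).
Proof.
move=> t; apply: (@continuous_comp _ _ _ (fun t : R => 2 * cos t) (horner p)).
  by apply: cvgMr; exact: continuous_cos.
exact: continuous_horner.
Qed.

Lemma circleD p r : circle (p + r) = circle p + circle r.
Proof.
have i r' : mu.-integrable `[0, pi] (EFin \o (fun t => r'.[2 * cos t])).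
  by apply: continuous_integrable; exact: continuous_horner_cos.
rewrite /circle -RintegralD//.
by apply: eq_Rintegral => t _; rewrite hornerD.
Qed.

Lemma circleZ a p : circle (a *: p) = a * circle p.
Proof.
rewrite /circle -RintegralZl//; last first.
  by apply: continuous_integrable; exact: continuous_horner_cos.
by apply: eq_Rintegral => t _; rewrite hornerZ.
Qed.

Lemma Rintegral_cos_sum (c : nat -> R) (e : nat -> R) N :
  (\int[mu]_(t in `[0%R, pi]) \sum_(0 <= k < N) c k * cos (e k * t))%R =
  \sum_(0 <= k < N) c k * (\int[mu]_(t in `[0%R, pi]) cos (e k * t))%R.
Proof.
have cc k : continuous (fun t : R => c k * cos (e k * t)).
  by move=> t; apply: cvgMr; exact: continuous_cosM.
have cS n : continuous (fun t : R => \sum_(0 <= k < n) c k * cos (e k * t)).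
  elim: n => [|n IHn] t.
    by under eq_fun do rewrite big_geq//; exact: cvg_cst.
  by under eq_fun do rewrite big_nat_recr//=; apply: cvgD; [exact: IHn|exact: cc].
elim: N => [|N IH].
  rewrite big_geq//; under eq_Rintegral do rewrite big_geq//.
  by rewrite Rintegral_cst//= mul0r.
rewrite big_nat_recr//= -IH -RintegralZl//; last first.
  by apply: continuous_integrable; exact: continuous_cosM.
rewrite -RintegralD//.
- by apply: eq_Rintegral => t _; rewrite big_nat_recr.
- apply: continuous_integrable; exact: cS.
- by apply: continuous_integrable; exact: cc.
Qed.

Variable q : R.
Hypothesis hq : -1 < q < 1.

(** In [qH_cos] only the constant mode k = n / 2 survives the integration. *)
Lemma circle_qH n : circle (qH q n) = if odd n then 0 else pi * qbin q n n./2.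
Proof.
rewrite /circle; under eq_Rintegral do rewrite (qH_cos hq).
rewrite Rintegral_cos_sum.
have E k : (\int[mu]_(t in `[0%R, pi]) cos ((n%:R - 2 * k%:R) * t))%R =
    if n == k.*2 then pi else 0 :> R.
  have [nk|nk] := leqP k.*2 n.
    have -> : n%:R - 2 * k%:R = (n - k.*2)%:R :> R.
      by rewrite natrB// -mul2n natrM.
    by rewrite integral_cos_natmul subn_eq0 eqn_leq nk andbT.
  rewrite (_ : (n == k.*2) = false); last by rewrite ltn_eqF.
  under eq_Rintegral do rewrite -cosN -mulNr.
  have -> : - (n%:R - 2 * k%:R) = (k.*2 - n)%:R :> R.
    by rewrite natrB ?(ltnW nk)// -mul2n natrM opprB.
  by rewrite integral_cos_natmul subn_eq0 leqNgt nk.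
under eq_bigr do rewrite E.
case: ifP => [on|en].
  apply: big1_seq => k _; rewrite ifF ?mulr0//; apply/negP => /eqP nk.
  by move: on; rewrite nk odd_double.
have nE : n = n./2.*2 by rewrite -[LHS]odd_double_half en.
have h : (n./2 < n.+1)%N by rewrite ltnS {2}nE -addnn leq_addr.
rewrite (bigD1_seq n./2) ?mem_index_iota ?iota_uniq//= -nE eqxx mulrC.
rewrite big1 ?addr0// => k kn; rewrite ifF ?mulr0//; apply/negP => /eqP nk.
by move: kn; rewrite nk doubleK eqxx.
Qed.

End circle.

(** * Bounded convergence *)

Section bounded_convergence.
Context d (T : measurableType d) (R : realType) (mu : {measure set T -> \bar R}).

Lemma bounded_convergence (D : set T) (f_ : nat -> T -> R) (f : T -> R) (C : R) :
  measurable D -> (mu D < +oo)%E -> (forall n, measurable_fun D (f_ n)) ->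
  (forall x, D x -> f_ ^~ x @ \oo --> f x) ->
  (forall n x, D x -> `|f_ n x| <= C) ->
  mu.-integrable D (EFin \o f) /\
  (fun n => (\int[mu]_(x in D) f_ n x)%R) @ \oo --> (\int[mu]_(x in D) f x)%R.
Proof.
move=> mD Doo mf_ f_f fC.
have mf : measurable_fun D f by exact: measurable_fun_cvg mf_ f_f.
have iC : mu.-integrable D (EFin \o cst C).
  by apply: measurable_bounded_integrable => //; exact: bounded_cst.
have mEf n : measurable_fun D (EFin \o f_ n) by apply/measurable_EFinP; exact: mf_.
have mEfl : measurable_fun D (EFin \o f) by exact/measurable_EFinP.
have cvE : {ae mu, forall x, D x ->
    (fun n => (EFin \o f_ n) x) @ \oo --> (EFin \o f) x}.
  by apply: aeW => x Dx; apply: cvg_EFin; [exact: nearW|exact: f_f].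
have bE : {ae mu, forall x n, D x -> (`|(EFin \o f_ n) x| <= (EFin \o cst C) x)%E}.
  by apply: aeW => x n Dx /=; rewrite lee_fin fC.
have [intf _ cv] := dominated_convergence mD mEf mEfl cvE iC bE.
split=> //; apply: fine_cvg.
rewrite fineK//; exact: integrable_fin_num.
Qed.

End bounded_convergence.

(** * Moments of the density fN *)

Section substitution.
Context {R : realType}.
Variable q : R.
Hypothesis hq : -1 < q < 1.
Local Notation mu := (@lebesgue_measure R).

Lemma continuous_scale : continuous (scale q).
Proof. by move=> x; apply: cvgMr; exact: cvg_id. Qed.

Lemma continuous_semicircle :
  continuous (fun x => Num.sqrt (1 - q) * Num.sqrt (4 - scale q x ^+ 2)).
Proof.
move=> x; apply: cvgMr.
apply: (@continuous_comp _ _ _ (fun x => 4 - scale q x ^+ 2) Num.sqrt);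
  last exact: sqrt_continuous.
apply: cvgB; first exact: cvg_cst.
by apply: cvgM; exact: continuous_scale.
Qed.

Lemma continuous_horner_scale (p : {poly R}) : continuous (fun x => p.[scale q x]).
Proof.
move=> x; apply: (@continuous_comp _ _ _ (scale q) (horner p)).
  exact: continuous_scale.
exact: continuous_horner.
Qed.

(** Substitute x = 2 cos t / sqrt (1 - q): the square root and the Jacobian each
    contribute a factor 2 sin t, and 4 - X^2 takes the value (2 sin t)^2. *)
Lemma semicircle_substitution (p : {poly R}) :
  (\int[mu]_(x in Sq q)
     (Num.sqrt (1 - q) * Num.sqrt (4 - scale q x ^+ 2) * p.[scale q x]))%R =
  circle ((4%:P - 'X^2) * p).
Proof.
have s0 := sqrt_gt0 hq.
set s := Num.sqrt (1 - q) in s0 *.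
pose F (t : R) := 2 / s * cos t.
have dF (t : R) : is_derive t (1 : R) F (- (2 / s * sin t)).
  have : is_derive t (1 : R) (2 / s *: (@cos R)) (2 / s *: - sin t).
    by apply: is_deriveZ.
  by rewrite /GRing.scale/= mulrN.
have cF : continuous F.
  by move=> t; apply/differentiable_continuous/derivable1_diffP; case: (dF t).
have dFE : derive1 F = (fun t => - (2 / s * sin t)).
  by apply/funext => t; rewrite derive1E; apply: derive_val.
have cdF : continuous (derive1 F).
  by rewrite dFE => t; apply: cvgN; apply: cvgMr; exact: continuous_sin.
pose G x := s * Num.sqrt (4 - scale q x ^+ 2) * p.[scale q x].
have cG : continuous G.
  move=> x; apply: cvgM; first exact: continuous_semicircle.
  exact: continuous_horner_scale.
have SqE : Sq q = `[F pi, F 0]%classic.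
  by rewrite /Sq /F cospi cos0 mulr1 mulrN1.
rewrite /Rintegral SqE (@integration_by_substitution_decreasing _ F G) ?pi_ge0//.
- rewrite /circle /Rintegral; congr fine; apply: eq_integral => t.
  rewrite inE/= in_itv/= => tpi; congr EFin.
  rewrite /= !fctE /G dFE opprK /F.
  have -> : scale q (2 / s * cos t) = 2 * cos t.
    by rewrite /scale -/s mulrA mulrCA divff ?mulr1// gt_eqF.
  have st : 0 <= sin t by exact: sin_ge0_pi.
  have -> : Num.sqrt (4 - (2 * cos t) ^+ 2) = 2 * sin t.
    have -> : 4 - (2 * cos t) ^+ 2 = (2 * sin t) ^+ 2.
      by have := cos2Dsin2 t; nra.
    by rewrite sqrtr_sqr ger0_norm// mulr_ge0.
  rewrite hornerM hornerD hornerN hornerXn hornerC.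
  have -> : 4 - (2 * cos t) ^+ 2 = (2 * sin t) ^+ 2.
    by have := cos2Dsin2 t; nra.
  have sn0 : s != 0 by rewrite gt_eqF.
  by field.
- move=> x y xpi ypi; rewrite /F ltr_pM2l ?divr_gt0//.
  by rewrite ltr_cos.
- by apply/cvg_ex; exists (derive1 F 0); exact/cvg_at_right_filter/cdF.
- by apply/cvg_ex; exists (derive1 F pi); exact/cvg_at_left_filter/cdF.
- split; first by move=> t _; case: (dF t).
  + exact/cvg_at_right_filter/cF.
  + exact/cvg_at_left_filter/cF.
- exact: continuous_subspaceT.
Qed.

End substitution.

Section moments.
Context {R : realType}.
Variable q : R.
Hypothesis hq : -1 < q < 1.
Local Notation mu := (@lebesgue_measure R).

Definition lq_poly N : {poly R} :=
  \prod_(0 <= k < N) (((1 + q ^+ k.+1) ^+ 2)%:P - q ^+ k.+1 *: 'X^2).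

Lemma trunc_weight_lq N : trunc_weight q N.+1 = (4%:P - 'X^2) * lq_poly N.
Proof.
rewrite /trunc_weight big_nat_recl// expr0 scale1r; congr (_ * _).
by congr (_%:P - _); ring.
Qed.

Lemma horner_lq_poly N x :
  (lq_poly N).[scale q x] = \prod_(0 <= k < N) lq x (q ^+ k.+1) q.
Proof.
rewrite horner_prod; apply: eq_bigr => k _.
by rewrite lqE// hornerD hornerN hornerZ hornerXn hornerC.
Qed.

Definition fN_cst := qpoch q q / (2 * pi).

Lemma qpoch_q_gt0 : 0 < qpoch q q.
Proof. by apply: qpoch_gt0 => //; exact: normq1. Qed.

Lemma fNE x : fN x q = fN_cst *
  (Num.sqrt (1 - q) * Num.sqrt (4 - scale q x ^+ 2) *
   infprod (fun k => lq x (q ^+ k.+1) q)).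
Proof. by rewrite /fN /fN_cst scale_sqr// !mulrA; congr (_ * _); ring. Qed.

Definition moment (p : {poly R}) : R :=
  (\int[mu]_(x in Sq q) (fN x q * p.[scale q x]))%R.

Lemma Sq_measurable : measurable (Sq q : set (measurableTypeR R)).
Proof. exact: measurable_itv. Qed.

Lemma Sq_finite : (mu (Sq q) < +oo)%E.
Proof.
by rewrite /Sq lebesgue_measure_itv/=; case: ifP => _; rewrite ?ltry// -EFinB ltry.
Qed.

Lemma Sq_bounded (f : R -> R) : continuous f ->
  exists M, forall x, Sq q x -> `|f x| <= M.
Proof.
move=> cf.
have le0 : - (2 / Num.sqrt (1 - q)) <= 2 / Num.sqrt (1 - q).
  by rewrite ge0_cp// divr_ge0// sqrtr_ge0.
have [|c _ hc] := @EVT_max _ (fun x => `|f x|) _ _ le0.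
  apply: continuous_subspaceT => x.
  apply: (@continuous_comp _ _ _ f (fun y => `|y|)); first exact: cf.
  exact: norm_continuous.
by exists `|f c| => x; rewrite /Sq/= => xS; apply: hc.
Qed.

(** When the infinite product in fN is cut after N factors, the moment becomes the
    integral of a polynomial of cos t, and the cut products are uniformly bounded. *)
Lemma moment_lim p :
  mu.-integrable (Sq q) (EFin \o (fun x => fN x q * p.[scale q x])) /\
  (fun N => fN_cst * circle (trunc_weight q N.+1 * p)) @ \oo --> moment p.
Proof.
pose g x := Num.sqrt (1 - q) * Num.sqrt (4 - scale q x ^+ 2).
have cg : continuous g by exact: continuous_semicircle.
pose f_ N x := fN_cst * (g x * (lq_poly N * p).[scale q x]).
have cf_ N : continuous (f_ N).
  move=> x; apply: cvgMr; apply: cvgM; first exact: cg.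
  exact: continuous_horner_scale.
have [M hM] : exists M, forall x, Sq q x -> `|fN_cst * (g x * p.[scale q x])| <= M.
  apply: Sq_bounded => x; apply: cvgMr; apply: cvgM; first exact: cg.
  exact: continuous_horner_scale.
have [B B0 hB] := lq_prod_bounded hq.
have [|||||] := @bounded_convergence _ _ _ mu (Sq q) f_
  (fun x => fN x q * p.[scale q x]) (M * B).
- exact: Sq_measurable.
- exact: Sq_finite.
- by move=> N; apply: measurable_funTS; exact: continuous_measurable_fun.
- move=> x xS; rewrite fNE.
  have -> : fN_cst * (g x * infprod (fun k => lq x (q ^+ k.+1) q)) * p.[scale q x] =
     (fN_cst * (g x * p.[scale q x])) * infprod (fun k => lq x (q ^+ k.+1) q) by ring.
  rewrite (_ : (fun n => f_ n x) = (fun n => (fN_cst * (g x * p.[scale q x])) *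
       \prod_(0 <= k < n) lq x (q ^+ k.+1) q)); last first.
    by apply/funext => n; rewrite /f_ hornerM horner_lq_poly; ring.
  by apply: cvgMr; exact: lq_prod_cvg.
- move=> n x xS; rewrite /f_ hornerM horner_lq_poly.
  rewrite [X in `|X|](_ : _ = (fN_cst * (g x * p.[scale q x])) *
       \prod_(0 <= k < n) lq x (q ^+ k.+1) q); last ring.
  by rewrite normrM ler_pM// ?hM// hB.
move=> i cv; split=> //.
rewrite (_ : (fun N => _) = (fun N => (\int[mu]_(x in Sq q) f_ N x)%R))//.
apply/funext => N; rewrite trunc_weight_lq -[_ * lq_poly N * p]mulrA.
rewrite -(semicircle_substitution hq).
rewrite -RintegralZl//; first exact: Sq_measurable.
apply: continuous_integrable => x; apply: cvgM; first exact: cg.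
exact: continuous_horner_scale.
Qed.

Lemma momentD p r : moment (p + r) = moment p + moment r.
Proof.
rewrite /moment -RintegralD.
- by apply: eq_Rintegral => x _; rewrite hornerD mulrDr.
- exact: Sq_measurable.
- exact: (moment_lim p).1.
- exact: (moment_lim r).1.
Qed.

Lemma momentZ a p : moment (a *: p) = a * moment p.
Proof.
rewrite /moment -RintegralZl.
- by apply: eq_Rintegral => x _; rewrite hornerZ mulrCA.
- exact: Sq_measurable.
- exact: (moment_lim p).1.
Qed.

Lemma qpochn_cvg : qpochn q @ \oo --> qpoch q q.
Proof. exact: (@qpoch_cvg _ _ hq q). Qed.

Lemma trunc_moment_cvg m :
  (fun N => trunc_moment q pi N m) @ \oo --> ((m == 0%N)%:R * (2 * pi / qpoch q q) : R).
Proof.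
have l0 : qpoch q q != 0 by rewrite gt_eqF// qpoch_q_gt0.
have shift (f : nat -> nat) : (forall n, (n <= f n)%N) ->
    (fun n => qpochn q (f n)) @ \oo --> qpoch q q.
  move=> nf; apply: (@cvg_comp _ _ _ f (qpochn q) _ \oo); last exact: qpochn_cvg.
  apply/cvgnyPge => A; exists A => // n /= An; exact: leq_trans (nf n).
have cN : (fun N => q ^+ N) @ \oo --> (0 : R) by apply: cvg_expr; exact: normq1.
have cm : (fun N => (q ^+ m) ^+ N) @ \oo --> ((m == 0%N)%:R : R).
  case: m => [|m]; last by apply: cvg_expr; exact: normr_qXS_lt1.
  by under eq_fun do rewrite expr0 expr1n; exact: cvg_cst.
(* the limit of all factors of the moment but q ^+ (N * m) *)
pose K : R := 2 * pi / (1 + 0) * (qpoch q q * qpochn q m.*2) /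
  (qpoch q q * qpochn q m * qpoch q q).
have -> : (m == 0%N)%:R * (2 * pi / qpoch q q) = (m == 0%N)%:R * K.
  case: m @K {cm} => [|m] K; rewrite ?mul0r// /K qpochn0.
  by field.
rewrite (_ : (fun N => _) = (fun N => (q ^+ m) ^+ N *
   (2 * pi / (1 + q ^+ N) * (qpochn q N.*2 * qpochn q m.*2) /
     (qpochn q N * qpochn q m * qpochn q (N + m))))); last first.
  by apply/funext => N; rewrite /trunc_moment -exprM (mulnC N); ring.
apply: cvgM => //; apply: cvgM.
  apply: cvgM.
    apply: cvgMr; apply: cvgV; first by rewrite addr0 oner_eq0.
    by apply: cvgD => //; exact: cvg_cst.
  by apply: cvgMl; apply: shift => n; rewrite -addnn leq_addr.
apply: cvgV; first by rewrite !mulf_neq0// qpochn_neq0.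
apply: cvgM; first by apply: cvgMl; exact: qpochn_cvg.
by apply: shift => n; rewrite leq_addr.
Qed.

(** In the limit of the truncated moments the powers q^(N m) leave only m = 0, whose
    value 2 pi / (q; q)_oo is the inverse of [fN_cst]; so fN is a probability
    density and the [qH n], n > 0, have mean 0. *)
Lemma moment_qH n : moment (qH q n) = (n == 0%N)%:R.
Proof.
have L_even k : circle (qH q k.*2) = pi * qbin q k.*2 k.
  by rewrite circle_qH// odd_double doubleK.
have L_odd k : circle (qH q k.*2.+1) = 0 by rewrite circle_qH//= odd_double.
have tm := @trunc_momentP R q hq (@circle R) (@circleD R) (@circleZ R) pi L_even L_odd.
have [m nE] : exists m, n = m.*2 \/ n = m.*2.+1.
  exists n./2; have := odd_double_half n; case: (odd n) => /= e; [right|left];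
  by rewrite -[LHS]e.
suff h : (fun N => fN_cst * circle (trunc_weight q N.+1 * qH q n)) @ \oo -->
    ((n == 0%N)%:R : R).
  exact: (cvg_unique _ (moment_lim (qH q n)).2 h).
case: nE => {n}->; last first.
  by under eq_fun do rewrite (tm _ _).2 mulr0; exact: cvg_cst.
rewrite double_eq0; under eq_fun do rewrite (tm _ _).1.
have -> : (m == 0%N)%:R = fN_cst * ((m == 0%N)%:R * (2 * pi / qpoch q q)).
  rewrite /fN_cst mulrCA -[LHS]mulr1; congr (_ * _).
  have A : qpoch q q != 0 by rewrite gt_eqF// qpoch_q_gt0.
  have B : (pi : R) != 0 by rewrite gt_eqF// pi_gt0.
  by rewrite mulf_div [X in X / _]mulrC divff ?mulf_neq0 ?pnatr_eq0.
apply: cvgMr; rewrite (cvg_shiftS (fun N => trunc_moment q pi N m)).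
exact: trunc_moment_cvg.
Qed.

Lemma moment_qHM m n : moment (qH q m * qH q n) = (m == n)%:R * qpochn q n.
Proof. exact: qH_orthogonal momentD momentZ moment_qH m n. Qed.

End moments.

(** * The Chapman-Kolmogorov identity *)

Section chapman_kolmogorov.
Context {R : realType}.
Variable q : R.
Hypothesis hq : -1 < q < 1.
Local Notation mu := (@lebesgue_measure R).
Implicit Types (a b x y z : R).

(** The ratio fCN (x | y, a, q) / fN (x | q). *)
Definition pm_kernel a x y := qpoch (a ^+ 2) q / omega_prod x y a q.

Lemma omegaC x y a : omega x y a q = omega y x a q.
Proof. by rewrite /omega; ring. Qed.

Lemma omega_prodC x y a : omega_prod x y a q = omega_prod y x a q.
Proof.
congr (limn _); apply/funext => n; apply: eq_bigr => k _; exact: omegaC.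
Qed.

Lemma omega_prodE x y a : omega_prod x y a q =
  infprod (fun k => mehler_den (scale q x) (scale q y) (a * q ^+ k)).
Proof.
congr (limn _); apply/funext => n; apply: eq_bigr => k _; exact: omegaE.
Qed.

Lemma omega_prod_cvg x y a : Sq q x -> Sq q y -> `|a| < 1 ->
  cvgn (fun n => \prod_(0 <= k < n) omega x y (a * q ^+ k) q).
Proof.
move=> xS yS a1; rewrite (_ : (fun n => _) = (fun n =>
    \prod_(0 <= k < n) mehler_den (scale q x) (scale q y) (a * q ^+ k))).
  by apply: mehler_prod_cvg => //; exact: scale_Sq.
by apply/funext => n; apply: eq_bigr => k _; exact: omegaE.
Qed.

Lemma omega_prod_gt0 x y a : Sq q x -> Sq q y -> `|a| < 1 -> 0 < omega_prod x y a q.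
Proof.
by move=> xS yS a1; rewrite omega_prodE; apply: mehler_prod_gt0 => //; exact: scale_Sq.
Qed.

Lemma normr_sqr_lt1 a : `|a| < 1 -> `|a ^+ 2| < 1.
Proof. by move=> a1; rewrite normrX expr_lt1. Qed.

Lemma pm_kernel_gt0 x y a : Sq q x -> Sq q y -> `|a| < 1 -> 0 < pm_kernel a x y.
Proof.
move=> xS yS a1; rewrite divr_gt0 ?omega_prod_gt0//.
by apply: qpoch_gt0 => //; exact: normr_sqr_lt1.
Qed.

(** A partial sum of the Poisson-Mehler series, as a polynomial in the scaled
    variable x. *)
Definition kernel_poly a y n : {poly R} :=
  \sum_(0 <= k < n) (a ^+ k * (qH q k).[scale q y] / qpochn q k) *: qH q k.

Lemma horner_kernel_poly a x y n : (kernel_poly a y n).[scale q x] =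
  series (fun k => mehler_coef q (scale q x) (scale q y) k * a ^+ k) n.
Proof.
rewrite /kernel_poly horner_sum; apply: eq_bigr => k _.
by rewrite hornerZ /mehler_coef; ring.
Qed.

Lemma kernel_poly_cvg a x y : Sq q x -> Sq q y -> `|a| < 1 ->
  (fun n => (kernel_poly a y n).[scale q x]) @ \oo --> pm_kernel a x y.
Proof.
move=> xS yS a1; rewrite /pm_kernel omega_prodE.
rewrite -(poisson_mehler hq (scale_Sq hq xS) (scale_Sq hq yS) a1).
under eq_fun do rewrite horner_kernel_poly.
by apply: mehler_sum_cvg => //; exact: scale_Sq.
Qed.

Lemma kernel_poly_bounded a : `|a| < 1 -> exists B, forall x y n,
  Sq q x -> Sq q y -> `|(kernel_poly a y n).[scale q x]| <= B.
Proof.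
move=> /(mehler_coef_bound hq)[B [c [B0 /andP[c0 c1] hB]]].
exists (B / (1 - c)) => x y n xS yS; rewrite horner_kernel_poly.
rewrite (le_trans (ler_norm_sum _ _ _))//.
apply: (@le_trans _ _ (series (geometric B c) n)).
  by apply: ler_sum => k _; apply: hB; exact: scale_Sq.
rewrite geometric_seriesE ?(negbT (lt_eqF c1))//=.
rewrite ler_wpM2r ?invr_ge0 ?subr_ge0 ?(ltW c1)//.
by rewrite ler_piMr ?(ltW B0)// gerBl exprn_ge0.
Qed.

(** By orthogonality only the diagonal of the double sum remains, and there the
    parameters a and b are multiplied. *)
Lemma moment_kernel_poly a b y z n :
  moment q (kernel_poly a y n * kernel_poly b z n) =
  series (fun k => mehler_coef q (scale q y) (scale q z) k * (a * b) ^+ k) n.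
Proof.
have m0 : moment q 0 = 0 by rewrite -[0 in LHS](scale0r (0 : {poly R})) momentZ// mul0r.
have msum := big_morph (moment q) (momentD hq) m0.
rewrite /kernel_poly big_distrl/= msum; apply: eq_big_nat => k /andP[_ kn].
rewrite big_distrr/= msum (bigD1_seq k) ?mem_index_iota ?iota_uniq//=.
rewrite big1 => [|j jk]; rewrite -scalerAl -scalerAr !momentZ// moment_qHM//.
  rewrite eqxx mul1r /mehler_coef exprMn addr0.
  by have Q := qpochn_neq0 hq k; field.
by rewrite eq_sym (negbTE jk) mul0r !mulr0.
Qed.

Lemma fN_bounded : exists M, forall x, Sq q x -> `|fN x q| <= M.
Proof.
have [B B0 hB] := lq_prod_bounded hq.
have [|M hM] := @Sq_bounded _ q (fun x =>
    fN_cst q * (Num.sqrt (1 - q) * Num.sqrt (4 - scale q x ^+ 2))).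
  by move=> x; apply: cvgMr; exact: continuous_semicircle.
exists (M * B) => x xS; rewrite fNE// mulrA normrM ler_pM// ?hM//.
have cv : (fun n => `|\prod_(0 <= k < n) lq x (q ^+ k.+1) q|) @ \oo -->
    `|infprod (fun k => lq x (q ^+ k.+1) q)|.
  by apply: cvg_norm; exact: lq_prod_cvg.
apply: (cvgr_to_le cv).
by apply: nearW => n; exact: hB.
Qed.

(** The identity holds for the partial sums of the Poisson-Mehler series, with the
    partial sum of the same order on the right; these are uniformly bounded on the
    support, so the integrals converge. *)
Lemma chapman_kolmogorov a b y z : `|a| < 1 -> `|b| < 1 -> Sq q y -> Sq q z ->
  mu.-integrable (Sq q)
    (EFin \o (fun x => fN x q * (pm_kernel a x y * pm_kernel b x z))) /\
  (\int[mu]_(x in Sq q) (fN x q * (pm_kernel a x y * pm_kernel b x z))%:E)%E =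
  (pm_kernel (a * b) y z)%:E.
Proof.
move=> a1 b1 yS zS.
have ab1 : `|a * b| < 1 by rewrite normrM mulr_ilt1.
have [M hM] := fN_bounded.
have [A hA] := kernel_poly_bounded a1; have [B hB] := kernel_poly_bounded b1.
have [|||||] := @bounded_convergence _ _ _ mu (Sq q)
  (fun n x => fN x q * (kernel_poly a y n * kernel_poly b z n).[scale q x])
  (fun x => fN x q * (pm_kernel a x y * pm_kernel b x z)) (M * (A * B)).
- exact: Sq_measurable.
- exact: Sq_finite.
- move=> n; apply/measurable_EFinP.
  by have [/measurable_int] := moment_lim hq (kernel_poly a y n * kernel_poly b z n).
- move=> x xS; apply: cvgMr; under eq_fun do rewrite hornerM.
  by apply: cvgM; exact: kernel_poly_cvg.
- move=> n x xS; rewrite hornerM (normrM (fN x q)).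
  apply: ler_pM; [by []|by []|exact: hM|].
  by rewrite normrM; apply: ler_pM => //; [exact: hA|exact: hB].
move=> i cv; split=> //; rewrite -[LHS]fineK; last first.
  by apply: integrable_fin_num => //; exact: Sq_measurable.
congr EFin; apply: (cvg_unique _ cv) => //.
rewrite (_ : (fun n => _) = series (fun k =>
    mehler_coef q (scale q y) (scale q z) k * (a * b) ^+ k)); last first.
  by apply/funext => n; rewrite -moment_kernel_poly.
rewrite /pm_kernel omega_prodE.
rewrite -(poisson_mehler hq (scale_Sq hq yS) (scale_Sq hq zS) ab1).
by apply: mehler_sum_cvg => //; exact: scale_Sq.
Qed.

End chapman_kolmogorov.

(** * Marginal densities *)

Section rectangles.
Local Open Scope ereal_scope.
Context d1 d2 (U : measurableType d1) (V : measurableType d2) (R : realType).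
Variables (mu : {sigma_finite_measure set U -> \bar R})
          (nu : {sigma_finite_measure set V -> \bar R}).
Variables (D : set U) (E : set V) (f : U * V -> R).
Hypotheses (mD : measurable D) (mE : measurable E)
  (mf : measurable_fun (D `*` E) f) (f0 : forall p, (D `*` E) p -> (0 <= f p)%R).

Let F := (EFin \o f) \_ (D `*` E).

Let mF : measurable_fun setT F.
Proof.
apply/(measurable_restrictT _ (measurableX mD mE)).
exact/measurable_EFinP.
Qed.

Let F0 p : 0 <= F p.
Proof. by apply: erestrict_ge0 => x DEx; rewrite lee_fin f0. Qed.

Let F_fst y : (fun x => F (x, y)) =
  (fun x => if y \in E then ((fun x => (f (x, y))%:E) \_ D) x else 0).
Proof.
by apply/funext => x; rewrite /F /patch in_setX; case: (x \in D); case: (y \in E).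
Qed.

Let F_snd x : (fun y => F (x, y)) =
  (fun y => if x \in D then ((fun y => (f (x, y))%:E) \_ E) y else 0).
Proof.
by apply/funext => y; rewrite /F /patch in_setX; case: (x \in D); case: (y \in E).
Qed.

Lemma integral_rectangle_fst : \int[mu \x nu]_(p in D `*` E) (f p)%:E =
  \int[mu]_(x in D) \int[nu]_(y in E) (f (x, y))%:E.
Proof.
rewrite integral_mkcond (fubini_tonelli1 _ mF F0) [RHS]integral_mkcond.
apply: eq_integral => x _; rewrite /patch /fubini_F F_snd; case: (x \in D).
  by rewrite -integral_mkcond.
by rewrite integral0.
Qed.

Lemma integral_rectangle_snd : \int[mu \x nu]_(p in D `*` E) (f p)%:E =
  \int[nu]_(y in E) \int[mu]_(x in D) (f (x, y))%:E.
Proof.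
rewrite integral_mkcond (fubini_tonelli2 _ mF F0) [RHS]integral_mkcond.
apply: eq_integral => y _; rewrite /patch /fubini_G F_fst; case: (y \in E).
  by rewrite -integral_mkcond.
by rewrite integral0.
Qed.

Lemma measurable_marginal : measurable_fun E (fun y => \int[mu]_(x in D) (f (x, y))%:E).
Proof.
have := @measurable_fun_fubini_tonelli_G _ _ _ _ _ mu _ mF F0.
move=> /(measurable_funS measurableT (@subsetT _ E)); apply: eq_measurable_fun.
by move=> y yE; rewrite /fubini_G F_fst yE -integral_mkcond.
Qed.

Lemma measurable_section x : D x -> measurable_fun E (fun y => f (x, y)).
Proof.
move=> Dx; apply/measurable_EFinP.
have /= := measurable_fun_pair2 x mF.
move=> /(measurable_funS measurableT (@subsetT _ E)); apply: eq_measurable_fun.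
by move=> y yE; rewrite /F /patch in_setX mem_set// yE.
Qed.

End rectangles.

Section densities.
Local Open Scope ereal_scope.
Context d (T : measurableType d) (R : realType) (P : probability T R).
Context d1 d2 (U : measurableType d1) (V : measurableType d2).
Variables (mu : {sigma_finite_measure set U -> \bar R})
          (nu : {sigma_finite_measure set V -> \bar R}).
Variables (X : T -> U) (W : T -> V) (D : set U) (E : set V) (h : U * V -> R).
Hypotheses (mD : measurable D) (mE : measurable E).
Hypothesis dens : has_density P (mu \x nu) (fun t => (X t, W t)) (D `*` E) h.

Lemma has_density_marginal (g : V -> R) :
  (forall w, E w -> \int[mu]_(u in D) (h (u, w))%:E = (g w)%:E) ->
  has_density P nu W E g.
Proof.
have [mh h0 hA] := dens; move=> hg; split.
- apply/measurable_EFinP; have := measurable_marginal mu mD mE mh h0.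
  by apply: eq_measurable_fun => w; rewrite inE => /hg.
- move=> w Ew; rewrite -lee_fin -hg//; apply: integral_ge0 => u Du.
  by rewrite lee_fin h0.
- move=> A mA; have := hA (setT `*` A) (measurableX measurableT mA).
  rewrite (_ : _ @^-1` _ = W @^-1` A); last by apply/seteqP; split => t //= -[].
  move=> ->.
  rewrite (_ : setT `*` A `&` D `*` E = D `*` (A `&` E)); last first.
    by apply/seteqP; split => -[u w] /=; tauto.
  rewrite integral_rectangle_snd//.
  + by apply: eq_integral => w; rewrite inE => -[_ /hg].
  + exact: measurableI.
  + apply: measurable_funS mh; first exact: measurableX.
    by move=> -[u w] /= [? []].
  + by move=> -[u w] /= [? [? ?]]; exact: h0.
Qed.

Lemma has_density_swap :
  has_density P (nu \x mu) (fun t => (W t, X t)) (E `*` D) (fun p => h (p.2, p.1)).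
Proof.
have [mh h0 hA] := dens.
have mS : measurable_fun (E `*` D) (fun p => h (p.2, p.1)).
  apply: (@measurable_comp _ _ _ _ _ _ (D `*` E) h _
    (fun p : V * U => (p.2, p.1))) => //.
  - exact: measurableX.
  - by move=> _ [[w u] /= [? ?] <-].
  - by apply: measurable_funTS; apply: measurable_fun_pair;
      [exact: measurable_snd|exact: measurable_fst].
split=> // [p [? ?]|A mA]; first exact: h0.
have mA' : measurable ((fun p : U * V => (p.2, p.1)) @^-1` A).
  by rewrite -[X in measurable X]setTI; apply: measurable_fun_pair.
have := hA _ mA'; rewrite (_ : _ @^-1` _ = (fun t => (W t, X t)) @^-1` A)// => ->.
set S := _ `&` _; set S' := _ `&` _.
have mSS : measurable S by apply: measurableI => //; exact: measurableX.
have mSS' : measurable S' by apply: measurableI => //; exact: measurableX.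
rewrite integral_mkcond [RHS]integral_mkcond.
pose H := (fun p => (h p)%:E) \_ S; pose H' := (fun p => (h (p.2, p.1))%:E) \_ S'.
have mH : measurable_fun setT H.
  apply/(measurable_restrictT _ mSS); apply/measurable_EFinP.
  by apply: measurable_funS mh; [exact: measurableX|exact: subIsetr].
have mH' : measurable_fun setT H'.
  apply/(measurable_restrictT _ mSS'); apply/measurable_EFinP.
  by apply: measurable_funS mS; [exact: measurableX|exact: subIsetr].
have H0 p : 0 <= H p by apply: erestrict_ge0 => x [_ ?]; rewrite lee_fin h0.
have H'0 p : 0 <= H' p by apply: erestrict_ge0 => x [_ [? ?]]; rewrite lee_fin h0.
rewrite (fubini_tonelli2 _ mH H0) (fubini_tonelli1 _ mH' H'0).
apply: eq_integral => w _; apply: eq_integral => u _.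
rewrite /H /H' /patch (_ : ((w, u) \in S') = ((u, w) \in S))//.
by apply/idP/idP; rewrite !inE => -[? [? ?]].
Qed.

End densities.

(** * The trivariate density *)

Section endpoints.
Context {R : realType}.
Variable q : R.
Hypothesis hq : -1 < q < 1.
Implicit Types (a b c x y z : R).
Local Notation leb := (@lebesgue_measure R).

Lemma fN_ge0 x : Sq q x -> 0 <= fN x q.
Proof.
move=> xS; rewrite fNE// mulr_ge0//.
  by rewrite divr_ge0 ?(ltW (qpoch_q_gt0 hq))// mulr_ge0// pi_ge0.
by rewrite !mulr_ge0 ?sqrtr_ge0// (ltW (lq_prod_gt0 hq xS)).
Qed.

Lemma fN_gt0 x : `|x| < 2 / Num.sqrt (1 - q) -> 0 < fN x q.
Proof.
move=> x2; have xS : Sq q x by rewrite /Sq/= in_itv/= -ler_norml ltW.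
have s0 := sqrt_gt0 hq.
rewrite fNE// mulr_gt0//; first by rewrite divr_gt0 ?qpoch_q_gt0// mulr_gt0// pi_gt0.
rewrite !mulr_gt0// ?(lq_prod_gt0 hq xS)// sqrtr_gt0 subr_gt0.
have : `|scale q x| < 2.
  by rewrite normrM gtr0_norm// mulrC -ltr_pdivlMr.
rewrite -real_normK ?num_real//; have := normr_ge0 (scale q x).
by move: `|_| => w ? ?; nra.
Qed.

(** The two points of the support at which fN vanishes. *)
Definition edge : set (measurableTypeR R) :=
  [set 2 / Num.sqrt (1 - q)] `|` [set - (2 / Num.sqrt (1 - q))].

Lemma edge_measurable : measurable edge.
Proof. by apply: measurableU; exact: measurable_set1. Qed.

Lemma edge_null : leb edge = 0%E.
Proof.
by apply: null_set_setU; do ?[exact: measurable_set1|exact: lebesgue_measure_set1].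
Qed.

Lemma edgeP x : Sq q x -> ~ edge x -> `|x| < 2 / Num.sqrt (1 - q).
Proof.
rewrite /Sq/= in_itv/= -ler_norml le_eqVlt => /predU1P[e|//] xe.
exfalso; apply: xe; rewrite /edge -e.
by case: (ger0P x) => _; [left|right; rewrite /= opprK].
Qed.

Definition edge2 : set (measurableTypeR R * measurableTypeR R) :=
  (edge `*` setT) `|` (setT `*` edge).

Lemma edge2_measurable : measurable edge2.
Proof.
by apply: measurableU; apply: measurableX => //; exact: edge_measurable.
Qed.

Lemma edge2_null : @lebesgue2 R edge2 = 0%E.
Proof.
apply: null_set_setU.
- by apply: measurableX => //; exact: edge_measurable.
- by apply: measurableX => //; exact: edge_measurable.
- apply: (@etrans _ _ (leb edge * leb setT)%E); last by rewrite edge_null mul0e.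
  by apply: product_measure1E => //; exact: edge_measurable.
- apply: (@etrans _ _ (leb setT * leb edge)%E); last by rewrite edge_null mule0.
  by apply: product_measure1E => //; exact: edge_measurable.
Qed.

Lemma pm_kernelC a x y : pm_kernel q a x y = pm_kernel q a y x.
Proof. by rewrite /pm_kernel omega_prodC. Qed.

Lemma f3D_unnormE a b c x y z : `|a| < 1 -> `|b| < 1 -> `|c| < 1 ->
  Sq q x -> Sq q y -> Sq q z ->
  f3D_unnorm x y z a b c q = fN x q * fN y q * fN z q *
    (pm_kernel q a x y * pm_kernel q b x z * pm_kernel q c y z).
Proof.
move=> a1 b1 c1 xS yS zS; rewrite /f3D_unnorm /pm_kernel.
have cxy := omega_prod_cvg hq xS yS a1.
have cxz := omega_prod_cvg hq xS zS b1.
have cyz := omega_prod_cvg hq yS zS c1.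
rewrite infprodM//; last first.
  by under eq_fun do rewrite big_split/=; exact: is_cvgM.
rewrite infprodM//.
rewrite -/(omega_prod x y a q) -/(omega_prod x z b q) -/(omega_prod y z c q).
by rewrite !invfM; ring.
Qed.

Lemma f3D_unnorm_ge0 a b c x y z : `|a| < 1 -> `|b| < 1 -> `|c| < 1 ->
  Sq q x -> Sq q y -> Sq q z -> 0 <= f3D_unnorm x y z a b c q.
Proof.
move=> a1 b1 c1 xS yS zS; rewrite f3D_unnormE//.
have k r u v : `|r| < 1 -> Sq q u -> Sq q v -> 0 <= pm_kernel q r u v.
  by move=> r1 uS vS; exact/ltW/pm_kernel_gt0.
have [A B C] := And3 (k _ _ _ a1 xS yS) (k _ _ _ b1 xS zS) (k _ _ _ c1 yS zS).
have [D E F] := And3 (fN_ge0 xS) (fN_ge0 yS) (fN_ge0 zS).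
by repeat (apply: mulr_ge0 => //).
Qed.

Lemma chapman_kolmogorov_scaled k a b y z : `|a| < 1 -> `|b| < 1 -> Sq q y -> Sq q z ->
  (\int[leb]_(x in Sq q) (k * (fN x q * (pm_kernel q a x y * pm_kernel q b x z)))%:E =
  (k * pm_kernel q (a * b) y z)%:E)%E.
Proof.
move=> a1 b1 yS zS; have [i e] := chapman_kolmogorov hq a1 b1 yS zS.
by rewrite [RHS]EFinM -e -integralZl//; exact: Sq_measurable.
Qed.

End endpoints.

(** * Conditional densities *)

Theorem proposition3 (R : realType) (d : measure_display)
    (T : measurableType d) (P : probability T R) (X Y Z : {RV P >-> R})
    (q rho12 rho13 rho23 : R)
    (hq : -1 < q < 1) (h12 : -1 < rho12 < 1)
    (h13 : -1 < rho13 < 1) (h23 : -1 < rho23 < 1)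
    (hXYZ : has_density P
      (@lebesgue_measure R \x @lebesgue2 R)%E
      (fun t => (X t, (Y t, Z t))) (Sq q `*` (Sq q `*` Sq q))
      (fun p => f3D p.1 p.2.1 p.2.2 rho12 rho13 rho23 q)) :
  let r := rho12 * rho13 * rho23 in
  let fX_YZ (x y z : R) :=
    fN x q
    * (qpoch (rho12 ^+ 2) q * qpoch (rho13 ^+ 2) q
         * infprod (fun i => omega y z (rho12 * rho13 * q ^+ i) q)
       / (qpoch (rho12 ^+ 2 * rho13 ^+ 2) q
          * infprod (fun i => omega x y (rho12 * q ^+ i) q
                              * omega x z (rho13 * q ^+ i) q))) in
  let fYZ_X (y z x : R) :=
    fCN x y rho12 q * fCN y z rho23 q * fCN z x rho13 q / fCN x x r q in
  [/\ is_cond_density P (@lebesgue_measure R) (@lebesgue2 R)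
        X (fun t => (Y t, Z t)) (Sq q) (Sq q `*` Sq q)
        (fun p => f3D p.1 p.2.1 p.2.2 rho12 rho13 rho23 q)
        (fun x yz => fX_YZ x yz.1 yz.2),
      (* at the two endpoints of Sq q the denominator below vanishes *)
      (forall x y z, Sq q x -> Sq q y -> Sq q z ->
         `|z| < 2 / Num.sqrt (1 - q) ->
         fX_YZ x y z =
         fCN x y rho12 q * fCN z x rho13 q / fCN z y (rho12 * rho13) q) &
      is_cond_density P (@lebesgue2 R) (@lebesgue_measure R)
        (fun t => (Y t, Z t)) X (Sq q `*` Sq q) (Sq q)
        (fun p => f3D p.2 p.1.1 p.1.2 rho12 rho13 rho23 q)
        (fun yz x => fYZ_X yz.1 yz.2 x)].
Proof.
move=> r fX_YZ fYZ_X.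
have [a1 b1 c1] : [/\ `|rho12| < 1, `|rho13| < 1 & `|rho23| < 1].
  by rewrite !ltr_norml.
have ab1 : `|rho12 * rho13| < 1 by rewrite normrM mulr_ilt1.
have bc1 : `|rho13 * rho23| < 1 by rewrite normrM mulr_ilt1.
have r1 : `|r| < 1 by rewrite normrM mulr_ilt1.
have mS := Sq_measurable q; have mS2 := measurableX mS mS.
have [mh h0 hA] := hXYZ.
pose C := C3D rho12 rho13 rho23 q.
pose K := pm_kernel q.
have KC a x y : K a x y = K a y x by exact: pm_kernelC.
have K0 a x y : `|a| < 1 -> Sq q x -> Sq q y -> 0 < K a x y.
  by move=> ? ? ?; exact: pm_kernel_gt0.
have fCNE a x y : fCN x y a q = fN x q * K a x y by [].
have f3DE x y z : Sq q x -> Sq q y -> Sq q z -> f3D x y z rho12 rho13 rho23 q =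
    C * (fN x q * fN y q * fN z q * (K rho12 x y * K rho13 x z * K rho23 y z)).
  by move=> xS yS zS; rewrite /f3D f3D_unnormE.
(* if the normalizing constant were 0, the joint law would have mass 0 *)
have C0 : 0 < C.
  rewrite lt_neqAle eq_sym; apply/andP; split; last first.
    rewrite invr_ge0; apply: Rintegral_ge0 => -[x [y z]] [xS [yS zS]].
    exact: f3D_unnorm_ge0.
  apply/eqP => C00; have := hA setT measurableT.
  rewrite preimage_setT probability_setT integral0_eq => [/eqP|p _].
    by rewrite onee_eq0.
  by rewrite /f3D -/C C00 mul0r.
have fXE x y z : Sq q x -> Sq q y -> Sq q z -> fX_YZ x y z =
    fN x q * (K rho12 x y * K rho13 x z) / K (rho12 * rho13) y z.
  move=> xS yS zS; rewrite /fX_YZ infprodM; [|exact: omega_prod_cvg..].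
  rewrite /K /pm_kernel -/(omega_prod x y rho12 q) -/(omega_prod x z rho13 q).
  rewrite -/(omega_prod y z (rho12 * rho13) q) exprMn !invfM invrK; ring.
split.
- split; first exact: hXYZ.
  exists (fun w => C * (fN w.1 q * fN w.2 q * K rho23 w.1 w.2)
                   * K (rho12 * rho13) w.1 w.2).
  split.
    apply: (has_density_marginal mS mS2 hXYZ) => -[y z] [/= yS zS].
    rewrite -(chapman_kolmogorov_scaled hq _ a1 b1 yS zS).
    apply: eq_integral => x; rewrite inE => xS; congr EFin.
    by rewrite f3DE// /K; ring.
  exists (edge2 q); split; [exact: edge2_measurable|exact: edge2_null|].
  move=> [y z] /=; apply: contra_notP => yz [yS zS].
  have y0 : 0 < fN y q.
    by apply: fN_gt0 => //; apply: edgeP => // ye; apply: yz; left.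
  have z0 : 0 < fN z q.
    by apply: fN_gt0 => //; apply: edgeP => // ze; apply: yz; right.
  have k1 := K0 _ _ _ c1 yS zS; have k2 := K0 _ _ _ ab1 yS zS.
  split=> [|x xS]; first by repeat (apply: mulr_gt0 => //).
  rewrite fXE// f3DE//=.
  by field; rewrite !gt_eqF.
- move=> x y z xS yS zS z2; rewrite fXE// !fCNE (KC _ z x) (KC _ z y).
  have z0 := fN_gt0 hq z2; have k2 := K0 _ _ _ ab1 yS zS.
  by field; rewrite !gt_eqF.
- have dens := has_density_swap mS mS2 hXYZ.
  split; first exact: dens.
  exists (fun x => C * fCN x x r q); split.
    apply: (has_density_marginal mS2 mS dens) => x xS /=.
    have mx := measurable_section mS mS2 mh xS.
    have hx p : (Sq q `*` Sq q) p -> 0 <= f3D x p.1 p.2 rho12 rho13 rho23 q.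
      by move=> pS; apply: (h0 (x, p)).
    (* z is integrated out first, which composes rho13 and rho23; then y *)
    rewrite (integral_rectangle_fst _ _ mS mS mx hx).
    transitivity (\int[@lebesgue_measure R]_(y in Sq q)
       (C * fN x q * (fN y q * (K rho12 y x * K (rho13 * rho23) y x)))%:E)%E.
      apply: eq_integral => y; rewrite inE => yS.
      transitivity ((C * fN x q * fN y q * K rho12 x y * K (rho13 * rho23) x y)%:E).
        rewrite -(chapman_kolmogorov_scaled hq _ b1 c1 xS yS).
        apply: eq_integral => z; rewrite inE => zS; congr EFin.
        by rewrite /= f3DE// -/K (KC _ z x) (KC _ z y); ring.
      by congr EFin; rewrite (KC _ x y) (KC _ x y); ring.
    rewrite (chapman_kolmogorov_scaled hq _ a1 bc1 xS xS) fCNE /r mulrA.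
    by rewrite mulrA.
  exists (edge q); split; [exact: edge_measurable|exact: edge_null|].
  move=> x; apply: contra_notP => xe xS.
  have x0 : 0 < fN x q by apply: fN_gt0 => //; exact: edgeP.
  have k1 := K0 _ _ _ r1 xS xS.
  split=> [|[y z] [/= yS zS]].
    by rewrite fCNE; repeat (apply: mulr_gt0 => //).
  rewrite /fYZ_X !fCNE f3DE// (KC _ z x).
  by field; rewrite !gt_eqF.
Qed.
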